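(* Let $\lambda>0$ and $\Lambda=3/\lambda^2$, and consider $\mathbb{R}\times\mathbb{R}^3$ with the (half-)de Sitter metric in planar coordinates $$\tilde g=-dt^2+e^{2t/\lambda}\left((dx^1)^2+(dx^2)^2+(dx^3)^2\right).$$ Let $t_0\in\mathbb{R}$. For $\varepsilon\in\mathbb{R}$ let $\Sigma_\varepsilon=\{(f(x),x):x\in\mathbb{R}^3\}$ be the graph of $$f(x)=t_0+\varepsilon(1+r^2)^{-1/2},\qquad r=|x|.$$ Then there is $\varepsilon_0>0$ such that for all $\varepsilon$ with $|\varepsilon|<\varepsilon_0$ the following hold. (1) $\Sigma_\varepsilon$ is an embedded spacelike hypersurface. With induced metric $g$ and second fundamental form $K$ (with respect to the future-directed unit normal), the initial data set $(\Sigma_\varepsilon\cong\mathbb{R}^3,g,K)$ is $\mathcal{P}$-asymptotically de Sitter (of some order $\tau>\frac12$) with the constant $\mathcal{P}=e^{t_0/\lambda}$. (2) Its total energy is $E=\frac{\varepsilon}{\lambda}e^{t_0/\lambda}$ and its total linear momentum is $P_k=0$ for $k=1,2,3$. In particular $E<0$ if $\varepsilon<0$. (3) If $\varepsilon\neq 0$, then $\mathrm{tr}_g(K)>\frac{3}{\lambda}=\sqrt{3\Lambda}$ for all sufficiently large $r$, so the condition $\mathrm{tr}_g(K)\le\sqrt{3\Lambda}$ is violated.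
   Context: Sign convention for $K$: $K=\frac12(\mathcal{L}_{e_0}\tilde g)^{proj}$, where $e_0$ is the timelike unit normal with positive $\partial_t$-component, $\mathcal{L}$ is the Lie derivative and $proj$ is projection to the tangent bundle of the hypersurface. Thus for a slice $t=$ const one has $K=\frac1\lambda g$ and $\mathrm{tr}_g(K)=\frac3\lambda$. $\mathcal{P}$-asymptotically de Sitter: let $M$ be a spacelike hypersurface with induced metric $g$ and second fundamental form $K$ in a spacetime with cosmological constant $\Lambda=3/\lambda^2$. $(M,g,K)$ is $\mathcal{P}$-asymptotically de Sitter of order $\tau>\frac12$, with positive constant $\mathcal{P}$, if there is a compact set $M_c$ such that $M\setminus M_c$ is a finite disjoint union of ends, each diffeomorphic to $\mathbb{R}^3$ minus a closed ball (here there is one end, with coordinates $x^1,x^2,x^3$), and the following hold. Put $h=K-\sqrt{\Lambda/3}\,g=K-\frac1\lambda g$ and define $\bar g,\bar h$ by $g=\mathcal{P}^2\bar g$, $h=\mathcal{P}\bar h$. Then, in the coordinates of each end, $$\bar g-\breve g\in C^{2,\alpha}_{-\tau},\qquad \bar h\in C^{1,\alpha}_{-\tau-1}$$ for some $0<\alpha<1$, where $\breve g$ is the Euclidean metric. Moreover, the scalar curvature of $g$ is in $L^1(M)$, and $T_{0i}\in L^1(M)$, where $T$ is the energy-momentum tensor defined by the Einstein equations with cosmological constant $\Lambda$, $0$ denotes the unit normal direction and $i$ a tangential direction (de Sitter spacetime is vacuum, so $T=0$ there). Weighted Hölder spaces: with $\sigma=(1+r^2)^{1/2}$, $C^{k,\alpha}_{-\beta}$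 consists of the $C^{k,\alpha}_{loc}$ tensors whose components $u$ satisfy $$\sum_{j\le k}\sup\sigma^{\beta+j}|\partial^j u|+\sup_x\ \sigma(x)^{\beta+k+\alpha}\sup_{0<4|x-y|\le\sigma(x)}\frac{|\partial^ku(x)-\partial^ku(y)|}{|x-y|^\alpha}<\infty.$$ Total energy and total linear momentum of the end: with $\bar g_{ij}=\bar g(\partial_i,\partial_j)$, $\bar h_{ij}=\bar h(\partial_i,\partial_j)$ and $S_r$ the coordinate sphere of radius $r$, $$E=\frac{\mathcal{P}}{16\pi}\lim_{r\to\infty}\int_{S_r}(\partial_j\bar g_{ij}-\partial_i\bar g_{jj})*dx^i,\qquad P_k=\frac{\mathcal{P}^2}{8\pi}\lim_{r\to\infty}\int_{S_r}\left(\bar h_{ki}-\bar g_{ki}\,\mathrm{tr}_{\bar g}(\bar h)\right)*dx^i,$$ with repeated indices summed, where $*$ is the Euclidean Hodge star, so on $S_r$ one has $*dx^i=\frac{x^i}{r}d\sigma_r$ with $d\sigma_r$ the Euclidean area element. *)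

(* Defs.v *)
From HB Require Import structures.
From mathcomp Require Import all_boot all_order all_algebra.
From mathcomp Require Import all_classical all_reals all_analysis.

Set Implicit Arguments.
Unset Strict Implicit.
Unset Printing Implicit Defensive.

Import Order.TTheory GRing.Theory Num.Theory.
Import numFieldNormedType.Exports.

Local Open Scope classical_set_scope.
Local Open Scope ring_scope.

(* Tensors are given by their components in a global chart.  Euclidean points,
   vectors and covectors are row vectors; the norm `|x| of 'rV[R]_n is the sup
   norm, hence the separate Euclidean norm. *)

Section Calculus.
Context {R : realType} {n : nat}.
Implicit Types (u : 'rV[R]_n -> R) (D : set 'rV[R]_n).

Definition enorm (x : 'rV[R]_n) : R := Num.sqrt (\sum_i x 0 i ^+ 2).

Definition weight (x : 'rV[R]_n) : R := Num.sqrt (1 + enorm x ^+ 2).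

Definition partial (i : 'I_n) u : 'rV[R]_n -> R :=
  fun x => 'D_(delta_mx 0 i) u x.

Definition partials (s : seq 'I_n) u : 'rV[R]_n -> R := foldr partial u s.

(* u is C^k on D; meant for open D. *)
Fixpoint Ck_on D (k : nat) u : Prop :=
  (forall x, D x -> {for x, continuous u}) /\
  (if k is k'.+1 then
     forall i, (forall x, D x -> derivable u x (delta_mx 0 i)) /\
               Ck_on D k' (partial i u)
   else True).

Definition smooth u : Prop := forall k, Ck_on setT k u.

Definition norm_der (j : nat) u (x : 'rV[R]_n) : R :=
  Num.sqrt (\sum_(s : j.-tuple 'I_n) partials s u x ^+ 2).

Definition dist_der (k : nat) u (x y : 'rV[R]_n) : R :=
  Num.sqrt (\sum_(s : k.-tuple 'I_n) (partials s u x - partials s u y) ^+ 2).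

Definition holder_norm D (k : nat) (alpha beta : R) u : \bar R :=
  (\sum_(j < k.+1)
      ereal_sup [set (weight x `^ (beta + j%:R) * norm_der j u x)%:E | x in D]
   + ereal_sup
      [set (weight xy.1 `^ (beta + k%:R + alpha)
            * (dist_der k u xy.1 xy.2 / enorm (xy.1 - xy.2)%R `^ alpha))%:E
      | xy in [set xy : 'rV[R]_n * 'rV[R]_n | D xy.1 /\ D xy.2 /\
                 (0 < 4 * enorm (xy.1 - xy.2) <= weight xy.1)%R]])%E.

(* u \in C^{k,alpha}_{-beta}(D).  As weight >= 1, finiteness of the last
   supremum contains the local Hoelder continuity of the k-th derivatives. *)
Definition weighted_holder D (k : nat) (alpha beta : R) u : Prop :=
  Ck_on D k u /\ (holder_norm D k alpha beta u < +oo)%E.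

End Calculus.

Section PseudoRiemannian.
Context {R : realType} {n : nat}.
Implicit Types (g : 'rV[R]_n -> 'M[R]_n).

Definition christoffel g (k i j : 'I_n) (x : 'rV[R]_n) : R :=
  2^-1 * \sum_l invmx (g x) k l *
    (partial i (fun y => g y j l) x + partial j (fun y => g y i l) x
     - partial l (fun y => g y i j) x).

Definition ricci g (x : 'rV[R]_n) : 'M[R]_n := \matrix_(i, j)
  \sum_k (partial k (christoffel g k i j) x - partial j (christoffel g k i k) x
          + \sum_l (christoffel g k k l x * christoffel g l i j x
                    - christoffel g k j l x * christoffel g l i k x)).

Definition mtrace (h b : 'M[R]_n) : R := \tr (invmx h *m b).

Definition scalar_curv g (x : 'rV[R]_n) : R := mtrace (g x) (ricci g x).

(* Ric - (Scal/2) g + Lam g = 8 pi T *)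
Definition energy_momentum (Lam : R) g (x : 'rV[R]_n) : 'M[R]_n :=
  (8 * pi)^-1 *: (ricci g x - (scalar_curv g x / 2) *: g x + Lam *: g x).

Definition lie_metric g (N : 'rV[R]_n -> 'rV[R]_n) (x : 'rV[R]_n) : 'M[R]_n :=
  \matrix_(a, b) \sum_c
    (N x 0 c * partial c (fun y => g y a b) x
     + g x c b * partial a (fun y => N y 0 c) x
     + g x a c * partial b (fun y => N y 0 c) x).

Definition pos_def (b : 'M[R]_n) : Prop :=
  b^T = b /\ forall v : 'rV[R]_n, v != 0 -> 0 < (v *m b *m v^T) 0 0.

End PseudoRiemannian.

(* Graphs of functions f : R^3 -> R in a spacetime R x R^3 with metric st;
   index 0 of 'rV_4 is the time coordinate. *)
Section Graph.
Context {R : realType}.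
Implicit Types (st : 'rV[R]_4 -> 'M[R]_4) (f : 'rV[R]_3 -> R).

Definition spatial (p : 'rV[R]_4) : 'rV[R]_3 := rsubmx (p : 'rV[R]_(1 + 3)).

Definition graph f (x : 'rV[R]_3) : 'rV[R]_4 := row_mx (f x)%:M x : 'rV_(1 + 3).

(* Row i is the tangent vector d_i F of the parametrised hypersurface F. *)
Definition tangents (F : 'rV[R]_3 -> 'rV[R]_4) (x : 'rV[R]_3) : 'M[R]_(3, 4) :=
  \matrix_(i, a) partial i (fun y => F y 0 a) x.

Definition embedding (F : 'rV[R]_3 -> 'rV[R]_4) : Prop :=
  [/\ forall a, smooth (fun x => F x 0 a),
      injective F,
      forall x, row_free (tangents F x) &
      (* homeomorphism onto the image *)
      forall U, open U -> exists V, open V /\ U = F @^-1` V].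

Definition induced_metric st f (x : 'rV[R]_3) : 'M[R]_3 :=
  tangents (graph f) x *m st (graph f x) *m (tangents (graph f) x)^T.

(* The covector d(t - f), which annihilates the tangent space of the graph. *)
Definition conormal f (x : 'rV[R]_3) : 'rV[R]_4 :=
  row_mx 1%:M (- \row_i partial i f x) : 'rV_(1 + 3).

(* e_0 along the graph: - grad (t - f) / |grad (t - f)|;
   see unit_normal_timelike, unit_normal_orthogonal, unit_normal_future. *)
Definition unit_normal st f (x : 'rV[R]_3) : 'rV[R]_4 :=
  let n := conormal f x in
  let gi := invmx (st (graph f x)) in
  - (Num.sqrt (- (n *m gi *m n^T) 0 0))^-1 *: (n *m gi).

(* The Lie derivative needs an extension of e_0 off the graph.  We take the one
   that is constant in t; the tangential projection of the Lie derivative only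
   involves derivatives of e_0 along the graph, so the choice is immaterial. *)
Definition normal_ext st f (p : 'rV[R]_4) : 'rV[R]_4 :=
  unit_normal st f (spatial p).

Definition second_ff st f (x : 'rV[R]_3) : 'M[R]_3 :=
  2^-1 *: (tangents (graph f) x *m lie_metric st (normal_ext st f) (graph f x)
           *m (tangents (graph f) x)^T).

(* The components T(e_0, d_i F) *)
Definition momentum_density Lam st f (x : 'rV[R]_3) : 'rV[R]_3 :=
  unit_normal st f x *m energy_momentum Lam st (graph f x)
  *m (tangents (graph f) x)^T.

Definition spacelike st f : Prop := forall x, pos_def (induced_metric st f x).

Lemma partial_coord (i j : 'I_3) (x : 'rV[R]_3) :
  partial i (fun y => y 0 j) x = (i == j)%:R.
Proof.
apply/cvg_lim => //.
apply: cvg_near_cst; near=> h.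
rewrite /= !mxE eqxx /= addrK [LHS]mulrA mulVf ?mul1r; last by near: h; exact: nbhs_dnbhs_neq.
by rewrite eq_sym.
Unshelve. all: by end_near.
Qed.

Lemma tangents_graph f (x : 'rV[R]_3) :
  tangents (graph f) x = (row_mx (\col_i partial i f x) 1%:M : 'M[R]_(3, 1 + 3)).
Proof.
apply/matrixP => i a.
have [b ->] : exists b : 'I_1 + 'I_3, a = unsplit b :> 'I_(1 + 3).
  by exists (fintype.split (a : 'I_(1 + 3))); rewrite splitK.
case: b => b /=.
  rewrite (@row_mxEl _ 3 1 3) [LHS]mxE [RHS]mxE; congr (partial i _ x).
  by apply/funext => y; rewrite /graph (@row_mxEl _ 1 1 3) mxE (ord1 b) eqxx.
rewrite (@row_mxEr _ 3 1 3) [LHS]mxE [RHS]mxE -(partial_coord i b x).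
congr (partial i _ x).
by apply/funext => y; rewrite /graph (@row_mxEr _ 1 1 3).
Qed.

Lemma conormal_tangents f (x : 'rV[R]_3) : conormal f x *m (tangents (graph f) x)^T = 0.
Proof.
rewrite tangents_graph /conormal (@tr_row_mx _ 3 1 3) (@mul_row_col _ 1 1 3) mul1mx.
rewrite trmx1 mulmx1; apply/rowP => i; rewrite !mxE.
by rewrite subrr.
Qed.

Section UnitNormal.
Variables (st : 'rV[R]_4 -> 'M[R]_4) (f : 'rV[R]_3 -> R) (x : 'rV[R]_3).
Let b := st (graph f x).
Hypotheses (b_sym : b^T = b) (b_unit : b \in unitmx).
Hypothesis timelike :
  (conormal f x *m invmx b *m (conormal f x)^T) 0 0 < 0.

Lemma unit_normal_orthogonal :
  unit_normal st f x *m b *m (tangents (graph f) x)^T = 0.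
Proof.
by rewrite -scalemxAl mulmxKV // -scalemxAl conormal_tangents scaler0.
Qed.

Lemma unit_normal_timelike :
  (unit_normal st f x *m b *m (unit_normal st f x)^T) 0 0 = -1.
Proof.
rewrite /unit_normal -/b -scalemxAl mulmxKV // linearZ /= trmx_mul trmx_inv b_sym.
rewrite -scalemxAl -scalemxAr scalerA mulmxA mxE mulrNN -invfM -expr2 sqr_sqrtr.
  by rewrite invrN mulNr mulVf // lt_eqF.
by rewrite oppr_ge0 ltW.
Qed.

End UnitNormal.

End Graph.

Section InitialData.
Context {R : realType}.
Implicit Types (g K : 'rV[R]_3 -> 'M[R]_3).

Notation leb := (@lebesgue_measure R).

Definition vec3 (x y z : R) : 'rV[R]_3 := \row_(i < 3) [:: x; y; z]`_i.

Definition integrable_vol g (u : 'rV[R]_3 -> R) : Prop :=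
  (leb \x (leb \x leb))%E.-integrable setT
    (fun p : R * (R * R) =>
       (u (vec3 p.1 p.2.1 p.2.2)
        * Num.sqrt (\det (g (vec3 p.1 p.2.1 p.2.2))))%:E).

Definition rescaled_metric (P : R) g (x : 'rV[R]_3) : 'M[R]_3 :=
  (P ^+ 2)^-1 *: g x.

Definition rescaled_h (Lam P : R) g K (x : 'rV[R]_3) : 'M[R]_3 :=
  P^-1 *: (K x - Num.sqrt (Lam / 3) *: g x).

Definition exterior (rho : R) : set 'rV[R]_3 := [set x | rho < enorm x].

(* Initial data (R^3, g, K) with one end, whose coordinates are x^1, x^2, x^3
   and whose complement M_c is a closed ball; T0 are the components T_{0i}. *)
Definition asymptotically_deSitter (Lam P tau : R) g K
    (T0 : 'rV[R]_3 -> 'rV[R]_3) : Prop :=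
  [/\ 0 < P /\ 2^-1 < tau,
      exists rho alpha : R, [/\ 0 < rho, 0 < alpha < 1,
        forall i j, weighted_holder (exterior rho) 2 alpha tau
          (fun x => (rescaled_metric P g x - 1%:M) i j) &
        forall i j, weighted_holder (exterior rho) 1 alpha (tau + 1)
          (fun x => rescaled_h Lam P g K x i j)],
      integrable_vol g (scalar_curv g) &
      forall i, integrable_vol g (fun x => T0 x 0 i)].

(* Integral over the Euclidean sphere of radius r, in spherical coordinates. *)
Definition sphere_integral (r : R) (u : 'rV[R]_3 -> R) : R :=
  \int[(leb \x leb)%E]_(a in `[0, pi] `*` `[0, 2 * pi])
    (u (vec3 (r * sin a.1 * cos a.2) (r * sin a.1 * sin a.2) (r * cos a.1))
     * (r ^+ 2 * sin a.1)).

(* \int_{S_r} w_i *dx^i *)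
Definition flux (w : 'rV[R]_3 -> 'rV[R]_3) (r : R) : R :=
  sphere_integral r (fun x => \sum_i w x 0 i * (x 0 i / r)).

Definition energy_at P g (r : R) : R :=
  let gb := rescaled_metric P g in
  P / (16 * pi) *
  flux (fun x => \row_i \sum_j (partial j (fun y => gb y i j) x
                                - partial i (fun y => gb y j j) x)) r.

Definition momentum_at Lam P g K (k : 'I_3) (r : R) : R :=
  let gb := rescaled_metric P g in
  let hb := rescaled_h Lam P g K in
  P ^+ 2 / (8 * pi) *
  flux (fun x => \row_i (hb x k i - gb x k i * mtrace (gb x) (hb x))) r.

Definition total_energy P g : R := lim (energy_at P g r @[r --> +oo]).

Definition total_momentum Lam P g K (k : 'I_3) : R :=
  lim (momentum_at Lam P g K k r @[r --> +oo]).

End InitialData.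

Definition deSitter {R : realType} (lam : R) (p : 'rV[R]_4) : 'M[R]_4 :=
  diag_mx (\row_a (if a == 0 then -1 else expR (2 * p 0 0 / lam))).

Lemma deSitter_unit {R : realType} (lam : R) p : deSitter lam p \in unitmx.
Proof.
rewrite unitmxE det_diag unitfE; apply/prodf_neq0 => i _; rewrite mxE.
by case: ifP => _; rewrite ?oppr_eq0 ?oner_eq0 // gt_eqF // expR_gt0.
Qed.

Lemma unit_normal_future {R : realType} (lam : R) f x :
  (conormal f x *m invmx (deSitter lam (graph f x)) *m (conormal f x)^T) 0 0 < 0 ->
  0 < unit_normal (deSitter lam) f x 0 0.
Proof.
move=> timelike; set nu := unit_normal _ _ _.
have : (nu *m deSitter lam (graph f x)) 0 0 = - nu 0 0.
  by rewrite mul_mx_diag !mxE eqxx mulrN1.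
rewrite /nu /unit_normal -scalemxAl mulmxKV ?deSitter_unit //.
move=> /(congr1 -%R); rewrite opprK => <-.
rewrite mxE [X in _ * X](_ : _ = 1).
  by rewrite mulr1 opprK invr_gt0 sqrtr_gt0 oppr_gt0.
rewrite /conormal [X in fun_of_matrix _ _ X](_ : _ = lshift 3 (0 : 'I_1)).
  by rewrite (@row_mxEl _ 1 1 3) mxE.
exact/val_inj.
Qed.

Definition perturbed_time {R : realType} (t0 eps : R) (x : 'rV[R]_3) : R :=
  t0 + eps * (1 + enorm x ^+ 2) `^ (- 2^-1).

(* Main.v *)
Require Import Defs.
From HB Require Import structures.
From mathcomp Require Import all_boot all_order all_algebra.
From mathcomp Require Import all_classical all_reals all_analysis.
From mathcomp Require Import measurable_realfun.
From mathcomp Require Import ring lra.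
Import Order.TTheory GRing.Theory Num.Theory.
Import numFieldNormedType.Exports.
Local Open Scope classical_set_scope.
Local Open Scope ring_scope.

(* Put s = (1 + r^2)^(-1/2) and p_i = s x_i, so that d_j s = - s^2 p_j and
   d_j p_i = s (delta_ij - p_i p_j).  All the geometry of the graph is generated by
   s, the p_i, exp (2 eps s / lam) and the tilt V = (1 - |df|^2 / a)^(-1/2), where
   a = exp (2 f / lam).  These belong to an algebra of symbols, graded by the decay
   at infinity and closed under differentiation, which gives every decay estimate.
   Explicitly
     g = a delta - df df,   K = V (d^2 f + (a / lam) delta - (2 / lam) df df),
   both combinations of delta_ij and p_i p_j with radial coefficients.  Hence the
   energy flux through a sphere is explicit, the momentum flux density is odd, and
   tr K - 3 / lam = |df|^2 / (2 a lam) + O(r^-5), since d^2 f only contributes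
   through its trace, which is O(r^-5).  The scalar curvature is integrable because
   modulo O(r^-4) it is linear in the perturbation, hence a multiple of the
   Laplacian of s, and T vanishes because de Sitter spacetime is vacuum. *)

Set Implicit Arguments.
Unset Strict Implicit.
Unset Printing Implicit Defensive.

(** * Partial derivatives *)

(** The threshold that shapes the proof is integrability of the scalar curvature on R^3: a metric
    perturbation of order 1 has curvature of order 3 in general, which fails logarithmically, so
    linear parts are kept explicit through the Christoffel symbols and the Ricci tensor until the
    trace can cancel. For K, by contrast, the slow 1/r variation of g is harmless: (a / lam) delta
    is matched by g / lam, and h inherits the decay of d^2 f. Using sqrt(1 + r^2) in place of r
    makes s and p_i smooth at the origin, so every estimate is global and no cutoff near the centre
    occurs. Smallness of eps enters only through [slope] <= 1/2: this makes the graph spacelike and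
    keeps 1 - |df|^2 / a away from 0, so that the tilt stays in the algebra. The value of the energy
    is visible in the linear part: for the rescaled metric (1 + c s) delta with c = 2 eps / lam the
    flux density is - 2 c d_i s, the total flux is 8 pi c, and P / (16 pi) times this is P c / 2 =
    (eps / lam) P. *)

Lemma sum_delta {R : nzRingType} {n : nat} (F : 'I_n -> R) (k : 'I_n) :
  \sum_i (k == i)%:R * F i = F k.
Proof.
rewrite (bigD1 k)//= eqxx mul1r big1 ?addr0// => i ik.
by rewrite eq_sym (negbTE ik) mul0r.
Qed.

Section PartialCalculus.
Context {R : realType} {n : nat}.
Implicit Types (u v : 'rV[R]_n.+1 -> R) (x : 'rV[R]_n.+1) (i : 'I_n.+1).

Lemma partial_cst i (c : R) : partial i (fun _ : 'rV[R]_n.+1 => c) = fun=> 0.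
Proof. by apply/funext => x; rewrite /partial derive_cst. Qed.

Lemma partial_coordinate i j :
  partial i (fun y : 'rV[R]_n.+1 => y 0 j) = fun=> (i == j)%:R.
Proof.
apply/funext => x; apply/cvg_lim => //.
apply: cvg_near_cst; near=> h.
rewrite /= !mxE eqxx /= addrK [LHS]mulrA mulVf ?mul1r; last first.
  by near: h; exact: nbhs_dnbhs_neq.
by rewrite eq_sym.
Unshelve. all: by end_near.
Qed.

Lemma partialD i u v x : differentiable u x -> differentiable v x ->
  partial i (fun y => u y + v y) x = partial i u x + partial i v x.
Proof. by move=> du dv; rewrite /partial deriveD//; exact: diff_derivable. Qed.

Lemma partialM i u v x : differentiable u x -> differentiable v x ->
  partial i (fun y => u y * v y) x = partial i u x * v x + u x * partial i v x.
Proof.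
move=> du dv; rewrite /partial.
rewrite (_ : (fun y => u y * v y) = u * v)// deriveM; try exact: diff_derivable.
by rewrite addrC /GRing.scale/= mulrC.
Qed.

Lemma partialMl i (c : R) u x : differentiable u x ->
  partial i (fun y => c * u y) x = c * partial i u x.
Proof.
by move=> du; rewrite partialM ?partial_cst ?mul0r ?add0r//; exact: differentiable_cst.
Qed.

Lemma partial_sum i (m : nat) (u : 'I_m -> 'rV[R]_n.+1 -> R) x :
  (forall j, differentiable (u j) x) ->
  partial i (fun y => \sum_j u j y) x = \sum_j partial i (u j) x.
Proof.
move=> du; rewrite /partial.
rewrite (_ : (fun y => \sum_j u j y) = \sum_j u j); last first.
  by apply/funext => y; rewrite fct_sumE.
by rewrite derive_sum// => j; exact: diff_derivable.
Qed.

Lemma differentiable_scalar_comp (phi : R -> R) u x (d : R) :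
  is_derive (u x) 1 phi d -> differentiable u x ->
  differentiable (fun y => phi (u y)) x.
Proof.
move=> [dphi _] du.
by apply: (@differentiable_comp _ _ _ _ u phi) => //; exact/derivable1_diffP.
Qed.

Lemma partial_comp i (phi : R -> R) u x (d : R) :
  is_derive (u x) 1 phi d -> differentiable u x ->
  partial i (fun y => phi (u y)) x = d * partial i u x.
Proof.
move=> dphi du; have dpu := differentiable_scalar_comp dphi du.
have /derivable1_diffP dp := @ex_derive _ _ _ _ _ _ _ dphi.
rewrite /partial deriveE// deriveE//.
rewrite (_ : (fun y => phi (u y)) = phi \o u)// diff_comp//=.
have <- : 'd phi (u x) 1 = d.
  by rewrite -deriveE// (@derive_val _ _ _ _ _ _ _ dphi).
by rewrite -[X in 'd phi _ X]mulr1 [LHS]linearZ mulrC.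
Qed.

Lemma derive_partial u x (v : 'rV[R]_n.+1) : differentiable u x ->
  'D_v u x = \sum_i v 0 i * partial i u x.
Proof.
move=> du; rewrite deriveE// [in LHS](row_sum_delta v) raddf_sum.
by apply: eq_bigr => i _; rewrite /partial deriveE//; exact: linearZ.
Qed.

End PartialCalculus.

(** * Symbols *)

Section Symbols.
Context {R : realType}.
Implicit Types (u v : 'rV[R]_3 -> R) (x : 'rV[R]_3) (k m : nat).

Definition decay x : R := (weight x)^-1.

Lemma weight_ge1 x : 1 <= weight x.
Proof. by rewrite -[leLHS]sqrtr1 ler_wsqrtr// lerDl sqr_ge0. Qed.

Lemma weight_gt0 x : 0 < weight x.
Proof. exact: lt_le_trans (weight_ge1 x). Qed.

Lemma decay_gt0 x : 0 < decay x.
Proof. by rewrite invr_gt0 weight_gt0. Qed.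

Lemma decay_le1 x : decay x <= 1.
Proof. by rewrite invf_le1 ?weight_gt0 ?weight_ge1. Qed.

Lemma enorm_sqr x : enorm x ^+ 2 = \sum_i x 0 i ^+ 2.
Proof. by rewrite sqr_sqrtr// sumr_ge0// => i _; exact: sqr_ge0. Qed.

Lemma weight_sqr x : weight x ^+ 2 = 1 + \sum_i x 0 i ^+ 2.
Proof. by rewrite sqr_sqrtr ?enorm_sqr// addr_ge0// -enorm_sqr sqr_ge0. Qed.

(* u is a symbol of order m when its derivatives of order j are O(r^-(m + j)).
   Measurability is recorded along the way, so that integrability needs no
   link between the Borel sets of 'rV_3 and those of R * (R * R). *)
Fixpoint symbol_upto k m u : Prop :=
  [/\ exists C, forall x, `|u x| <= C * decay x ^+ m,
      forall x, differentiable u x,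
      measurable_fun setT (fun p : R * (R * R) => u (vec3 p.1 p.2.1 p.2.2)) &
      if k is k'.+1 then forall i, symbol_upto k' m.+1 (partial i u) else True].

Definition symbol m u : Prop := forall k, symbol_upto k m u.

Lemma symbol_upto_bound k m u : symbol_upto k m u ->
  exists2 C, 0 <= C & forall x, `|u x| <= C * decay x ^+ m.
Proof.
case: k => [|k] [[C uC] _ _ _]; exists `|C| => // x; rewrite (le_trans (uC x))//;
  by rewrite ler_wpM2r ?ler_norm// exprn_ge0// ltW// decay_gt0.
Qed.

Lemma symbol_upto_differentiable k m u x : symbol_upto k m u -> differentiable u x.
Proof. by case: k => [|k] []. Qed.

Lemma symbol_upto_measurable k m u : symbol_upto k m u ->
  measurable_fun setT (fun p : R * (R * R) => u (vec3 p.1 p.2.1 p.2.2)).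
Proof. by case: k => [|k] []. Qed.

(** Introduction rule for both shapes of [k] at once: the clause on derivatives is only asked for
    when [k] is a successor. *)
Lemma symbol_upto_step k m u :
  (exists C, forall x, `|u x| <= C * decay x ^+ m) ->
  (forall x, differentiable u x) ->
  measurable_fun setT (fun p : R * (R * R) => u (vec3 p.1 p.2.1 p.2.2)) ->
  (forall j, k = j.+1 -> forall i, symbol_upto j m.+1 (partial i u)) ->
  symbol_upto k m u.
Proof. by case: k => [|k] uC du mu pu; split => // i; exact: pu. Qed.

Lemma symbol_upto_partial k m u i : symbol_upto k.+1 m u ->
  symbol_upto k m.+1 (partial i u).
Proof. by case=> _ _ _; apply. Qed.

(** Needed for the Leibniz rule, where the undifferentiated factor has to come down to the level of
    the differentiated one. *)
Lemma symbol_uptoS k m u : symbol_upto k.+1 m u -> symbol_upto k m u.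
Proof.
elim: k m u => [|k IH] m u [uC du mu pu]; split=> // i.
exact: IH (pu i).
Qed.

Lemma decayX_le m m' x : (m' <= m)%N -> decay x ^+ m <= decay x ^+ m'.
Proof. by move=> mm'; rewrite ler_wiXn2l ?decay_le1 ?ltW ?decay_gt0. Qed.

Lemma symbol_upto_le k m m' u : (m' <= m)%N -> symbol_upto k m u -> symbol_upto k m' u.
Proof.
elim: k m m' u => [|k IH] m m' u mm' su; have [C C0 uC] := symbol_upto_bound su;
  case: su => _ du mu pu; (split => //;
    first by exists C => x; rewrite (le_trans (uC x))// ler_wpM2l// decayX_le).
by move=> i; exact: IH (pu i).
Qed.

Lemma symbol_upto_cst k c : symbol_upto k 0 (fun=> c).
Proof.
have s0 m j : symbol_upto j m (fun=> 0).
  elim: j m => [|j IH] m; split => //; try by [exists 0 => x; rewrite normr0 mul0r].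
  by move=> i; rewrite partial_cst; exact: IH.
case: k => [|k]; split => //.
- by exists `|c| => x; rewrite mulr1.
- by exists `|c| => x; rewrite mulr1.
- by move=> i; rewrite partial_cst; exact: s0.
Qed.

Lemma symbol_uptoD k m u v : symbol_upto k m u -> symbol_upto k m v ->
  symbol_upto k m (fun x => u x + v x).
Proof.
elim: k m u v => [|k IH] m u v su sv;
  have [C C0 uC] := symbol_upto_bound su; have [D D0 vD] := symbol_upto_bound sv;
  have du x := symbol_upto_differentiable x su;
  have dv x := symbol_upto_differentiable x sv;
  have mu := symbol_upto_measurable su; have mv := symbol_upto_measurable sv.
all: apply: symbol_upto_step;
  [by exists (C + D) => x; rewrite mulrDl (le_trans (ler_normD _ _))// lerD
  |by move=> x; exact: differentiableD|exact: measurable_funD|].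
  by [].
move=> j [<-{j}] i.
rewrite (_ : partial i _ = fun x => partial i u x + partial i v x).
  exact: IH (symbol_upto_partial i su) (symbol_upto_partial i sv).
by apply/funext => x; rewrite partialD.
Qed.

(** Each term of the Leibniz rule differentiates a single factor, and that factor supplies the extra
    order. *)
Lemma symbol_uptoM k m1 m2 u v : symbol_upto k m1 u -> symbol_upto k m2 v ->
  symbol_upto k (m1 + m2) (fun x => u x * v x).
Proof.
elim: k m1 m2 u v => [|k IH] m1 m2 u v su sv;
  have [C C0 uC] := symbol_upto_bound su; have [D D0 vD] := symbol_upto_bound sv;
  have du x := symbol_upto_differentiable x su;
  have dv x := symbol_upto_differentiable x sv;
  have mu := symbol_upto_measurable su; have mv := symbol_upto_measurable sv.
all: apply: symbol_upto_step;
  [by exists (C * D) => x; rewrite normrM exprD mulrACA ler_pM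
  |by move=> x; exact: differentiableM|exact: measurable_funM|].
  by [].
move=> j [<-{j}] i.
rewrite (_ : partial i _ = fun x => partial i u x * v x + u x * partial i v x).
  apply: symbol_uptoD.
    by rewrite -addSn; apply: IH (symbol_upto_partial i su) (symbol_uptoS sv).
  by rewrite -addnS; apply: IH (symbol_uptoS su) (symbol_upto_partial i sv).
by apply/funext => x; rewrite partialM.
Qed.

Lemma symbol_bound m u : symbol m u ->
  exists2 C, 0 <= C & forall x, `|u x| <= C * decay x ^+ m.
Proof. by move=> /(_ 0); exact: symbol_upto_bound. Qed.

Lemma symbol_differentiable m u x : symbol m u -> differentiable u x.
Proof. by move=> /(_ 0); exact: symbol_upto_differentiable. Qed.

Lemma symbol_measurable m u : symbol m u ->
  measurable_fun setT (fun p : R * (R * R) => u (vec3 p.1 p.2.1 p.2.2)).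
Proof. by move=> /(_ 0); exact: symbol_upto_measurable. Qed.

Lemma symbol_le m m' u : (m' <= m)%N -> symbol m u -> symbol m' u.
Proof. by move=> mm' su k; exact: symbol_upto_le (su k). Qed.

Lemma symbol_cst c : symbol 0 (fun=> c).
Proof. by move=> k; exact: symbol_upto_cst. Qed.

Lemma symbolD m u v : symbol m u -> symbol m v -> symbol m (fun x => u x + v x).
Proof. by move=> su sv k; exact: symbol_uptoD. Qed.

Lemma symbolM m1 m2 u v : symbol m1 u -> symbol m2 v ->
  symbol (m1 + m2) (fun x => u x * v x).
Proof. by move=> su sv k; exact: symbol_uptoM. Qed.

Lemma symbolMl m c u : symbol m u -> symbol m (fun x => c * u x).
Proof. by move=> su; apply: (symbolM (symbol_cst c)). Qed.

Lemma symbol0 m : symbol m (fun=> 0).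
Proof.
elim: m => [|m IH]; first exact: symbol_cst.
have := symbol_cst 0; move=> s0 k; elim: k m {IH s0} => [|k IH] m; split => //.
- by exists 0 => x; rewrite normr0 mul0r.
- by exists 0 => x; rewrite normr0 mul0r.
- by move=> i; rewrite partial_cst; exact: IH.
Qed.

Lemma symbolN m u : symbol m u -> symbol m (fun x => - u x).
Proof.
move=> su; rewrite (_ : (fun x => _) = fun x => -1 * u x); first exact: symbolMl.
by apply/funext => x; rewrite mulN1r.
Qed.

Lemma symbolB m u v : symbol m u -> symbol m v -> symbol m (fun x => u x - v x).
Proof. by move=> su sv; apply: symbolD => //; exact: symbolN. Qed.

Lemma symbol_sum m (I : Type) (r : seq I) (u : I -> 'rV[R]_3 -> R) :
  (forall j, symbol m (u j)) -> symbol m (fun x => \sum_(j <- r) u j x).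
Proof.
move=> su; elim: r => [|j r IH].
  rewrite (_ : (fun _ => _) = fun=> 0); first exact: symbol0.
  by apply/funext => x; rewrite big_nil.
rewrite (_ : (fun _ => _) = fun x => u j x + \sum_(j <- r) u j x).
  exact: symbolD.
by apply/funext => x; rewrite big_cons.
Qed.

Lemma symbol_prod (I : Type) (r : seq I) (u : I -> 'rV[R]_3 -> R) :
  (forall j, symbol 0 (u j)) -> symbol 0 (fun x => \prod_(j <- r) u j x).
Proof.
move=> su; elim: r => [|j r IH].
  rewrite (_ : (fun _ => _) = fun=> 1); first exact: symbol_cst.
  by apply/funext => x; rewrite big_nil.
rewrite (_ : (fun _ => _) = fun x => u j x * \prod_(j <- r) u j x).
  exact: (symbolM (m1 := 0)).
by apply/funext => x; rewrite big_cons.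
Qed.

Lemma symbolX m u n : symbol m u -> symbol (n * m) (fun x => u x ^+ n).
Proof.
move=> su; elim: n => [|n IH]; first exact: symbol_cst.
rewrite (_ : (fun _ => _) = fun x => u x * u x ^+ n); first exact: symbolM.
by apply/funext => x; rewrite exprS.
Qed.

Lemma symbol_partial m u i : symbol m u -> symbol m.+1 (partial i u).
Proof. by move=> su k; exact: symbol_upto_partial (su k.+1). Qed.

(* Derivatives only see the leading terms of an expansion. *)
Lemma symbol_partialB m u v i : symbol m (fun x => u x - v x) ->
  (forall x, differentiable u x) -> (forall x, differentiable v x) ->
  symbol m.+1 (fun x => partial i u x - partial i v x).
Proof.
move=> suv du dv.
rewrite (_ : (fun x => _) = partial i (fun x => u x - v x)).
  exact: symbol_partial.
apply/funext => x; rewrite -[- partial i v x]mulN1r -partialMl// -partialD//.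
  by congr (partial i _ x); apply/funext => y; rewrite mulN1r.
by apply: differentiableM => //; exact: differentiable_cst.
Qed.

Lemma symbol_partials m u (l : seq 'I_3) : symbol m u -> symbol (m + size l) (partials l u).
Proof.
elim: l => [|i l IH] su; first by rewrite addn0.
by rewrite /= addnS; apply: symbol_partial; exact: IH.
Qed.

Lemma symbol_Ck_on D k m u : symbol m u -> Ck_on D k u.
Proof.
elim: k m u => [|k IH] m u su; (split; last first) => //.
- by move=> x _; apply: differentiable_continuous; exact: symbol_differentiable su.
- move=> i; split; last by apply: (IH m.+1); exact: symbol_partial.
  by move=> x _; apply: diff_derivable; exact: symbol_differentiable su.
- by move=> x _; apply: differentiable_continuous; exact: symbol_differentiable su.
Qed.

End Symbols.

(** * Generators of the algebra of symbols: [decay], directions, exponentials, inverse square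
    roots *)

Section BasicSymbols.
Context {R : realType}.
Implicit Types (x : 'rV[R]_3) (k m : nat) (c : R).

Lemma is_derive_invsqrt (t : R) : 0 < t ->
  is_derive t 1 (fun t => (Num.sqrt t)^-1) (- 2^-1 * (Num.sqrt t)^-1 ^+ 3).
Proof.
move=> t0; have s0 : Num.sqrt t != 0 by rewrite gt_eqF// sqrtr_gt0.
have dV := is_deriveV s0 (is_derive1_sqrt t0).
apply: is_derive_eq dV _; rewrite /GRing.scale/=; field; exact: s0.
Qed.

(** A substitute for the unit radial vector x_i / r that is smooth at the origin; its squared length
    falls short of 1 by s^2. *)
Definition dirn (i : 'I_3) x : R := decay x * x 0 i.

Let differentiable_coord_sqr i x : differentiable (fun y : 'rV[R]_3 => y 0 i ^+ 2) x.
Proof.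
have d : differentiable (fun y : 'rV[R]_3 => y 0 i) x by exact: differentiable_coord.
exact: (differentiableM d d).
Qed.

Let differentiable_sum_sqr x : differentiable (fun y : 'rV[R]_3 => \sum_i y 0 i ^+ 2) x.
Proof.
rewrite (_ : (fun y : 'rV[R]_3 => _) = \sum_i (fun y : 'rV[R]_3 => y 0 i ^+ 2)).
  exact: differentiable_sum.
by apply/funext => y; rewrite fct_sumE.
Qed.

Lemma differentiable_sqnorm x :
  differentiable (fun y : 'rV[R]_3 => 1 + \sum_i y 0 i ^+ 2) x.
Proof. by apply: differentiableD; first exact: differentiable_cst. Qed.

Lemma partial_sqnorm i x :
  partial i (fun y : 'rV[R]_3 => 1 + \sum_j y 0 j ^+ 2) x = 2 * x 0 i.
Proof.
have dc j : differentiable (fun y : 'rV[R]_3 => y 0 j) x by exact: differentiable_coord.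
rewrite partialD; [|exact: differentiable_cst|exact: differentiable_sum_sqr].
rewrite partial_cst add0r partial_sum//.
rewrite (bigD1 i)//= big1 ?addr0; last first.
  move=> j ji; rewrite (partialM i (dc j) (dc j)) partial_coordinate.
  by rewrite eq_sym (negbTE ji) mul0r mulr0 addr0.
rewrite (partialM i (dc i) (dc i)) partial_coordinate eqxx mul1r mulr1.
by rewrite mulr_natl.
Qed.

Lemma decayE : (@decay R) = fun x => (Num.sqrt (1 + \sum_i x 0 i ^+ 2))^-1.
Proof. by apply/funext => x; rewrite /decay /weight enorm_sqr. Qed.

Let sqnorm_gt0 x : 0 < 1 + \sum_i x 0 i ^+ 2.
Proof. by rewrite -weight_sqr exprn_gt0// weight_gt0. Qed.

Lemma differentiable_decay x : differentiable (@decay R) x.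
Proof.
rewrite decayE.
exact: (differentiable_scalar_comp (is_derive_invsqrt (sqnorm_gt0 x)) (differentiable_sqnorm x)).
Qed.

Lemma partial_decay i : partial i (@decay R) = fun x => - (decay x ^+ 2 * dirn i x).
Proof.
apply/funext => x; rewrite /dirn decayE.
rewrite (partial_comp i (is_derive_invsqrt (sqnorm_gt0 x)) (differentiable_sqnorm x)).
by rewrite partial_sqnorm; field; rewrite gt_eqF// sqrtr_gt0.
Qed.

Lemma differentiable_dirn i x : differentiable (dirn i) x.
Proof.
apply: differentiableM; first exact: differentiable_decay.
exact: differentiable_coord.
Qed.

Lemma partial_dirn i j : partial i (dirn j) =
  fun x => decay x * ((i == j)%:R - dirn i x * dirn j x).
Proof.
apply/funext => x; rewrite /dirn partialM; last 2 first.
- exact: differentiable_decay.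
- exact: differentiable_coord.
by rewrite partial_decay partial_coordinate /dirn; ring.
Qed.

Lemma partial2_decay i j : partial i (partial j (@decay R)) =
  fun x => decay x ^+ 3 * (3 * dirn i x * dirn j x - (i == j)%:R).
Proof.
apply/funext => x; rewrite partial_decay.
have dd := differentiable_decay x; have dp := differentiable_dirn j x.
have d2 : differentiable (fun y => decay y * decay y) x by exact: (differentiableM dd dd).
have d3 : differentiable (fun y => decay y * decay y * dirn j y) x.
  exact: (differentiableM d2 dp).
rewrite (_ : (fun x0 => _) = fun y => - 1 * (decay y * decay y * dirn j y)); last first.
  by apply/funext => y; rewrite expr2 mulN1r.
rewrite (partialMl _ _ d3) (partialM i d2 dp) (partialM i dd dd).
by rewrite partial_decay partial_dirn; ring.
Qed.

Lemma dirn_sqr_sum x : \sum_i dirn i x ^+ 2 = 1 - decay x ^+ 2.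
Proof.
have w0 : weight x != 0 by rewrite gt_eqF// weight_gt0.
have -> : \sum_i dirn i x ^+ 2 = decay x ^+ 2 * (weight x ^+ 2 - 1).
  rewrite weight_sqr addrAC subrr add0r mulr_sumr.
  by apply: eq_bigr => i _; rewrite /dirn exprMn.
by rewrite /decay; field.
Qed.

Lemma normr_dirn_le1 i x : `|dirn i x| <= 1.
Proof.
rewrite -(@ler_pXn2r _ 2)// ?nnegrE// expr1n real_normK ?num_real//.
apply: (@le_trans _ _ (\sum_j dirn j x ^+ 2)).
  by rewrite (bigD1 i)//= lerDl sumr_ge0// => j _; exact: sqr_ge0.
by rewrite dirn_sqr_sum lerBlDr lerDl sqr_ge0.
Qed.

Let measurable_vec3 (i : 'I_3) :
  measurable_fun setT (fun p : R * (R * R) => vec3 p.1 p.2.1 p.2.2 0 i).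
Proof.
case: i => [[|[|[|//]]] lti].
- rewrite (_ : (fun p => _) = fst); first exact: measurable_fst.
  by apply/funext => p; rewrite mxE.
- rewrite (_ : (fun p => _) = fst \o snd); first exact: measurableT_comp.
  by apply/funext => p; rewrite mxE.
- rewrite (_ : (fun p => _) = snd \o snd); first exact: measurableT_comp.
  by apply/funext => p; rewrite mxE.
Qed.

Let measurable_invsqrt : measurable_fun setT (fun t : R => (Num.sqrt t)^-1).
Proof.
rewrite (_ : (fun t : R => _) = (@powR R ^~ (-1)) \o Num.sqrt).
  apply: measurableT_comp; first exact: measurable_powR.
  by apply: continuous_measurable_fun; exact: sqrt_continuous.
by apply/funext => t /=; rewrite powR_inv1// sqrtr_ge0.
Qed.

Let measurable_decay :
  measurable_fun setT (fun p : R * (R * R) => decay (vec3 p.1 p.2.1 p.2.2)).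
Proof.
rewrite decayE.
apply: (@measurableT_comp _ _ _ _ _ _ (fun t : R => (Num.sqrt t)^-1)).
  exact: measurable_invsqrt.
apply: measurable_funD; first exact: measurable_cst.
apply: measurable_sum => i; apply: measurable_funX.
exact: measurable_vec3.
Qed.

(** One simultaneous induction, because the derivatives of s involve the p_i and those of p_i
    involve s. *)
Let symbol_upto_basic k : symbol_upto k 1 (@decay R) /\ forall i, symbol_upto k 0 (dirn i).
Proof.
have bs : exists C, forall x, `|decay x| <= C * decay x ^+ 1.
  by exists 1 => x; rewrite mul1r expr1 ger0_norm// ltW// decay_gt0.
have bd i : exists C, forall x, `|dirn i x| <= C * decay x ^+ 0.
  by exists 1 => x; rewrite mulr1 normr_dirn_le1.
have md i : measurable_fun setT (fun p : R * (R * R) => dirn i (vec3 p.1 p.2.1 p.2.2)).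
  by apply: measurable_funM; [exact: measurable_decay|exact: measurable_vec3].
elim: k => [|k [IHs IHd]]; split.
- by split => // x; exact: differentiable_decay.
- by move=> i; split => // x; exact: differentiable_dirn.
- split => // [x|i]; first exact: differentiable_decay.
  rewrite partial_decay.
  rewrite (_ : (fun x => _) = fun x => -1 * ((decay x * decay x) * dirn i x)).
    have := symbol_uptoM (symbol_uptoM IHs IHs) (IHd i).
    exact: symbol_uptoM (symbol_upto_cst _ _).
  by apply/funext => x; rewrite mulN1r expr2.
- move=> i; split => // [x|j]; first exact: differentiable_dirn.
  rewrite partial_dirn.
  rewrite (_ : (fun x => _) =
    fun x => decay x * ((j == i)%:R + -1 * (dirn j x * dirn i x))).
    apply: (symbol_uptoM (m1 := 1) (m2 := 0)) => //; apply: symbol_uptoD.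
      exact: symbol_upto_cst.
    apply: (symbol_uptoM (m1 := 0) (m2 := 0)); first exact: symbol_upto_cst.
    exact: symbol_uptoM (IHd j) (IHd i).
  by apply/funext => x; rewrite mulN1r.
Qed.

Lemma symbol_decay : symbol 1 (@decay R).
Proof. by move=> k; have [] := symbol_upto_basic k. Qed.

Lemma symbol_dirn i : symbol 0 (dirn i).
Proof. by move=> k; have [] := symbol_upto_basic k. Qed.

Lemma symbol_decayX m : symbol m (fun x : 'rV[R]_3 => decay x ^+ m).
Proof. by have := symbolX m symbol_decay; rewrite muln1. Qed.

Definition expdecay c x : R := expR (c * decay x).

Lemma expdecay_gt0 c x : 0 < expdecay c x.
Proof. exact: expR_gt0. Qed.

Lemma differentiable_expdecay c x : differentiable (expdecay c) x.
Proof.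
apply: (@differentiable_scalar_comp _ _ expR (fun y => c * decay y)).
apply: differentiableM; [exact: differentiable_cst|exact: differentiable_decay].
Qed.

Lemma partial_expdecay c i : partial i (expdecay c) =
  fun x => - (c * expdecay c x * decay x ^+ 2 * dirn i x).
Proof.
apply/funext => x.
have dd : differentiable (fun y => c * decay y) x.
  by apply: differentiableM; [exact: differentiable_cst|exact: differentiable_decay].
rewrite (partial_comp i (is_derive_expR (c * decay x)) dd).
rewrite partialMl ?partial_decay; last exact: differentiable_decay.
by rewrite /expdecay; ring.
Qed.

Lemma expdecay_le c x : expdecay c x <= expR `|c|.
Proof.
rewrite ler_expR (le_trans (ler_norm _))// normrM ler_piMr//.
by rewrite ger0_norm ?decay_le1// ltW// decay_gt0.
Qed.

Lemma symbol_expdecay c : symbol 0 (expdecay c).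
Proof.
have b : exists C, forall x, `|expdecay c x| <= C * decay x ^+ 0.
  exists (expR `|c|) => x; rewrite mulr1 ger0_norm ?expdecay_le//.
  by rewrite ltW// expdecay_gt0.
have mE : measurable_fun setT (fun p : R * (R * R) => expdecay c (vec3 p.1 p.2.1 p.2.2)).
  apply: measurableT_comp => //; apply: measurable_funM; [exact: measurable_cst|exact: measurable_decay].
move=> k; elim: k => [|k IH].
  by split => // x; exact: differentiable_expdecay.
split => // [x|i]; first exact: differentiable_expdecay.
rewrite partial_expdecay.
rewrite (_ : (fun x => _) =
    fun x => - c * (expdecay c x * (decay x ^+ 2 * dirn i x))).
  apply: (symbol_uptoM (m1 := 0)); first exact: symbol_upto_cst.
  apply: (symbol_uptoM (m1 := 0)) => //.
  apply: (@symbol_upto_le _ _ 2) => //.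
  apply: (symbolM (m1 := 2) (m2 := 0)); last exact: symbol_dirn.
  exact: symbol_decayX.
by apply/funext => x; ring.
Qed.

(** By convexity z <= e^z - 1 <= z e^z; the upper bound is 1 - z <= e^(-z) multiplied by e^z. *)
Lemma normr_expRB1_le (z : R) : `|expR z - 1| <= `|z| * (1 + expR z).
Proof.
have h1 := expR_ge1Dx z; have h2 := expR_ge1Dx (- z).
have e0 := expR_gt0 z.
have h3 : expR z - 1 <= z * expR z.
  have : (1 - z) * expR z <= 1.
    by rewrite -[leRHS]expR0 -(addNr z) expRD ler_pM2r.
  by rewrite mulrBl mul1r; lra.
rewrite ler_norml; apply/andP; split.
  have := ler_norm (- z); rewrite normrN => h.
  have := normr_ge0 z; nra.
have := ler_norm z; have := normr_ge0 z; nra.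
Qed.

(** The remainder is nonnegative and at most z (e^z - 1), which the first-order bound makes
    quadratic. *)
Lemma normr_expRB1B_le (z : R) : `|expR z - 1 - z| <= z ^+ 2 * (1 + expR z).
Proof.
have h1 := expR_ge1Dx z; have h2 := expR_ge1Dx (- z).
have e0 := expR_gt0 z.
have h3 : expR z - 1 <= z * expR z.
  have : (1 - z) * expR z <= 1.
    by rewrite -[leRHS]expR0 -(addNr z) expRD ler_pM2r.
  by rewrite mulrBl mul1r; lra.
rewrite ger0_norm; last lra.
have h4 : expR z - 1 - z <= z * (expR z - 1) by nra.
apply: (le_trans h4); rewrite (le_trans (ler_norm _))// normrM.
rewrite -[z ^+ 2]real_normK ?num_real// expr2 -mulrA ler_wpM2l//.
exact: normr_expRB1_le.
Qed.

Let expdecay_bound c x : 1 + expdecay c x <= 1 + expR `|c|.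
Proof. by rewrite lerD2l expdecay_le. Qed.

(** Subtracting 1 improves only the bound on the function itself; its derivatives are those of
    [expdecay c], which already have order 2. *)
Lemma symbol_expdecayB1 c : symbol 1 (fun x => expdecay c x - 1).
Proof.
have s0 := symbolB (symbol_expdecay c) (symbol_cst 1).
move=> k; apply: symbol_upto_step.
- exists (`|c| * (1 + expR `|c|)) => x.
  rewrite expr1 (le_trans (normr_expRB1_le _))// normrM.
  rewrite [`|decay x|]ger0_norm; last by rewrite ltW// decay_gt0.
  rewrite mulrAC ler_wpM2r ?(ltW (decay_gt0 _))// ler_wpM2l//; exact: expdecay_bound.
- by move=> x; exact: symbol_differentiable s0.
- exact: symbol_measurable s0.
move=> j _ i.
rewrite (_ : partial i _ = fun x => - c * (expdecay c x * (decay x ^+ 2 * dirn i x))).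
  apply: symbolMl; apply: (symbolM (m1 := 0)); first exact: symbol_expdecay.
  apply: (symbolM (m1 := 2) (m2 := 0)); last exact: symbol_dirn.
  exact: symbol_decayX.
apply/funext => x; rewrite partialD ?partial_cst ?partial_expdecay; first by ring.
  exact: differentiable_expdecay.
exact: differentiable_cst.
Qed.

(** Differentiation reproduces the previous remainder: the derivative is - c ([expdecay c] - 1) s^2
    p_i, of order 1 + 2. *)
Lemma symbol_expdecayB1B c : symbol 2 (fun x => expdecay c x - 1 - c * decay x).
Proof.
have s0 := symbolB (symbol_expdecayB1 c) (symbolMl c symbol_decay).
move=> k; apply: symbol_upto_step.
- exists (`|c| ^+ 2 * (1 + expR `|c|)) => x.
  rewrite (le_trans (normr_expRB1B_le _))// exprMn real_normK ?num_real//.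
  rewrite mulrAC ler_wpM2r ?sqr_ge0// ler_wpM2l ?sqr_ge0//; exact: expdecay_bound.
- by move=> x; exact: symbol_differentiable s0.
- exact: symbol_measurable s0.
move=> j _ i.
rewrite (_ : partial i _ = fun x => - c * ((expdecay c x - 1) * (decay x ^+ 2 * dirn i x))).
  apply: symbolMl; apply: (symbolM (m1 := 1)); first exact: symbol_expdecayB1.
  apply: (symbolM (m1 := 2) (m2 := 0)); last exact: symbol_dirn.
  exact: symbol_decayX.
have de x := differentiable_expdecay c x; have dd x := @differentiable_decay x.
apply/funext => x.
rewrite (_ : (fun y => _) = fun y => (expdecay c y + -1) + (- c) * decay y); last first.
  by apply/funext => y; ring.
have d1 : differentiable (fun y => expdecay c y + -1) x.
  by apply: differentiableD => //; exact: differentiable_cst.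
have d2 : differentiable (fun y : 'rV[R]_3 => - c * decay y) x.
  by apply: differentiableM => //; exact: differentiable_cst.
have dc : differentiable (fun=> -1 : R) x by exact: differentiable_cst.
rewrite (partialD i d1 d2) (partialD i (de x) dc).
by rewrite partialMl// partial_cst partial_expdecay partial_decay; ring.
Qed.

(** For V = (1 - Y)^(-1/2) one has dV = V^3 dY / 2, so the induction closes on V and Y alone; Y <=
    1/2 bounds V. The order of V - 1 is read off from V^2 - 1 = V^2 Y. *)
Lemma symbol_invsqrt m (Y : 'rV[R]_3 -> R) : symbol m Y -> (forall x, Y x <= 2^-1) ->
  symbol 0 (fun x => (Num.sqrt (1 - Y x))^-1) /\
  symbol m (fun x => (Num.sqrt (1 - Y x))^-1 - 1).
Proof.
move=> sY Yle; set V := fun x => _.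
have Y0 x : 0 < 1 - Y x by have := Yle x; lra.
have V2 x : V x ^+ 2 * (1 - Y x) = 1.
  by rewrite /V exprVn sqr_sqrtr ?ltW// mulVf// gt_eqF.
have V0 x : 0 <= V x by rewrite invr_ge0 sqrtr_ge0.
have Vle x : V x <= 2.
  by have := V2 x; have := Yle x; have := V0 x; nra.
have dY x : differentiable (fun y => 1 - Y y) x.
  apply: differentiableD; first exact: differentiable_cst.
  by apply: differentiableN; exact: symbol_differentiable sY.
have dV x : differentiable V x.
  exact: differentiable_scalar_comp (is_derive_invsqrt (Y0 x)) (dY x).
have pV i x : partial i V x = 2^-1 * (V x ^+ 3 * partial i Y x).
  rewrite (partial_comp i (is_derive_invsqrt (Y0 x)) (dY x)).
  rewrite (_ : (fun y => 1 - Y y) = fun y => 1 + -1 * Y y); last first.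
    by apply/funext => y; rewrite mulN1r.
  have dYx := symbol_differentiable x sY.
  have dNY : differentiable (fun y => -1 * Y y) x.
    by apply: differentiableM => //; exact: differentiable_cst.
  have dc : differentiable (fun=> 1 : R) x by exact: differentiable_cst.
  rewrite (partialD i dc dNY).
  by rewrite partial_cst partialMl// /V; ring.
have mV : measurable_fun setT (fun p : R * (R * R) => V (vec3 p.1 p.2.1 p.2.2)).
  apply: (@measurableT_comp _ _ _ _ _ _ (fun t : R => (Num.sqrt t)^-1)).
    exact: measurable_invsqrt.
  by apply: measurable_funB; [exact: measurable_cst|exact: symbol_measurable sY].
have sV : symbol 0 V.
  move=> k; elim: k => [|k IH].
    by split => //; exists 2 => x; rewrite mulr1 ger0_norm.
  split => //; first by exists 2 => x; rewrite mulr1 ger0_norm.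
  move=> i; rewrite (_ : partial i V = fun x => 2^-1 * (V x * V x * V x * partial i Y x)).
    apply: (symbol_uptoM (m1 := 0)); first exact: symbol_upto_cst.
    have VV := symbol_uptoM (symbol_uptoM IH IH) IH.
    by apply: (symbol_uptoM VV); apply: (@symbol_le _ m.+1) => //; exact: symbol_partial.
  by apply/funext => x; rewrite pV !exprSr expr0 mul1r.
split => // k.
have sV1 := symbolB sV (symbol_cst 1).
apply: symbol_upto_step.
- have [C C0 YC] := symbol_bound sY.
  exists (4 * C) => x; rewrite -mulrA.
  apply: (@le_trans _ _ (4 * `|Y x|)); last by rewrite ler_wpM2l.
  (* V^2 - 1 = (V - 1)(V + 1) and V + 1 >= 1. *)
  have h : `|V x - 1| <= `|V x ^+ 2 - 1|.
    rewrite (_ : V x ^+ 2 - 1 = (V x - 1) * (V x + 1)); last by ring.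
    by rewrite normrM ler_peMr// ger0_norm ?lerDr// addr_ge0.
  rewrite (le_trans h)// (_ : V x ^+ 2 - 1 = V x ^+ 2 * Y x).
    rewrite normrM ler_wpM2r// ger0_norm ?sqr_ge0//.
    by have := Vle x; have := V0 x; nra.
  by have := V2 x; lra.
- by move=> x; exact: symbol_differentiable sV1.
- exact: symbol_measurable sV1.
move=> j _ i; rewrite (_ : partial i _ = fun x => 2^-1 * (V x ^+ 3 * partial i Y x)).
  apply: symbolMl; apply: (symbolM (m1 := 0)); last exact: symbol_partial.
  exact: (symbolX 3 sV).
have dc x : differentiable (fun=> -1 : R) x by exact: differentiable_cst.
by apply/funext => x; rewrite (partialD i (dV x) (dc x)) partial_cst addr0 pV.
Qed.

End BasicSymbols.

(** * Weighted Hoelder spaces *)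

Section WeightedHolder.
Context {R : realType}.
Implicit Types (u : 'rV[R]_3 -> R) (x y : 'rV[R]_3).

(** A point z of the segment has |x - z| <= |x - y| <= weight(x) / 4, so weight(x)^2 <= 1 + 2 |z|^2
    + weight(x)^2 / 8; hence weight(x) <= 2 weight(z). *)
Lemma decay_segment x y (t : R) : 0 <= t <= 1 -> 4 * enorm (x - y) <= weight x ->
  decay (y + t *: (x - y)) <= 2 * decay x.
Proof.
move=> /andP[t0 t1] xy; set z := y + _.
have w0 := weight_gt0 x; have z0 := weight_gt0 z.
rewrite /decay ler_pdivlMr// mulrC -ler_pdivlMr ?invr_gt0// invrK.
suff h : weight x ^+ 2 <= (2 * weight z) ^+ 2.
  by rewrite -(@ler_pXn2r _ 2)// nnegrE ltW// mulr_gt0.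
have h1 : 16 * enorm (x - y) ^+ 2 <= weight x ^+ 2.
  have e0 : 0 <= enorm (x - y) by exact: sqrtr_ge0.
  by nra.
have h2 : \sum_i x 0 i ^+ 2 <= 2 * \sum_i z 0 i ^+ 2 + 2 * enorm (x - y) ^+ 2.
  rewrite enorm_sqr !mulr_sumr -big_split/=; apply: ler_sum => i _.
  have -> : x 0 i = z 0 i + (1 - t) * (x - y) 0 i by rewrite /z !mxE; ring.
  set a := z 0 i; set b := (x - y) 0 i.
  have : (1 - t) ^+ 2 <= 1 by nra.
  have := sqr_ge0 (a - (1 - t) * b); have := sqr_ge0 b; nra.
have h3 : 0 <= \sum_i z 0 i ^+ 2 by rewrite sumr_ge0// => i _; exact: sqr_ge0.
by rewrite exprMn !weight_sqr in h1 *; lra.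
Qed.

Lemma enorm_ge_coord x i : `|x 0 i| <= enorm x.
Proof.
rewrite -(@ler_pXn2r _ 2)// ?nnegrE ?sqrtr_ge0//.
rewrite enorm_sqr real_normK ?num_real// (bigD1 i)//= lerDl.
by rewrite sumr_ge0// => j _; exact: sqr_ge0.
Qed.

Lemma is_derive_segment u y (d : 'rV[R]_3) (t : R) : differentiable u (y + t *: d) ->
  is_derive (t : R) (1 : R) (fun t : R => u (y + t *: d)) ('D_d u (y + t *: d)).
Proof.
move=> du; split.
  apply/derivable1_diffP.
  apply: (@differentiable_comp _ _ _ _ (fun t : R => y + t *: d) u) => //.
have E : (fun h : R => h^-1 *: (((fun t : R => u (y + t *: d)) \o shift t) (h *: (1 : R))
                               - u (y + t *: d))) =
         (fun h : R => h^-1 *: ((u \o shift (y + t *: d)) (h *: d) - u (y + t *: d))).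
  apply/funext => h /=; congr (_ *: (u _ - _)).
  by rewrite [_ *: 1]mulr1 scalerDl addrCA.
by rewrite /derive E.
Qed.

(* Mean value theorem along the segment from y to x, on which the weights are comparable. *)
Lemma symbol_lipschitz m u : symbol m u -> exists2 C, 0 <= C &
  forall x y, 4 * enorm (x - y) <= weight x ->
    `|u x - u y| <= C * enorm (x - y) * decay x ^+ m.+1.
Proof.
move=> su.
have /choice[C HC] : forall i, exists C, 0 <= C /\
    forall x, `|partial i u x| <= C * decay x ^+ m.+1.
  by move=> i; have [C C0 HC] := symbol_bound (symbol_partial i su); exists C.
have C0 i : 0 <= C i by have [] := HC i.
exists (\sum_i C i * 2 ^+ m.+1).
  by rewrite sumr_ge0// => i _; rewrite mulr_ge0// exprn_ge0.
move=> x y xy; pose d := x - y.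
have dell t := is_derive_segment (symbol_differentiable (y + t *: d) su).
have cell : {within `[0, 1], continuous (fun t : R => u (y + t *: d))}.
  apply: continuous_subspaceT => t; apply: differentiable_continuous.
  by apply/derivable1_diffP; have [] := dell t.
have [t t01] := MVT_segment ler01 (fun t _ => dell t) cell.
rewrite scale1r scale0r addr0 subr0 mulr1 (addrC y) subrK => ->.
rewrite derive_partial; last exact: symbol_differentiable su.
rewrite (le_trans (ler_norm_sum _ _ _))//.
rewrite -mulrA mulr_suml; apply: ler_sum => i _.
have [_ Hi] := HC i.
rewrite normrM mulrAC -!mulrA.
apply: (@le_trans _ _ (enorm d * (C i * (2 * decay x) ^+ m.+1))).
  apply: ler_pM => //; first exact: enorm_ge_coord.
  apply: (le_trans (Hi _)); rewrite ler_wpM2l// lerXn2r ?nnegrE//.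
  - by rewrite ltW// decay_gt0.
  - by rewrite mulr_ge0// ltW// decay_gt0.
  - by apply: decay_segment => //; move: t01; rewrite in_itv.
by rewrite exprMn le_eqVlt; apply/orP; left; apply/eqP; rewrite /d; ring.
Qed.

Lemma sqrt_sum_sqr_le (I : finType) (F : I -> R) :
  Num.sqrt (\sum_i F i ^+ 2) <= \sum_i `|F i|.
Proof.
have S0 : 0 <= \sum_i `|F i| by rewrite sumr_ge0.
rewrite -[leRHS](ger0_norm S0) -sqrtr_sqr ler_wsqrtr//.
rewrite [leRHS]expr2 mulr_suml; apply: ler_sum => i _.
rewrite -[F i ^+ 2]real_normK ?num_real// expr2 ler_wpM2l//.
by rewrite (bigD1 i)//= lerDl sumr_ge0.
Qed.

Lemma symbol_norm_der m u (j : nat) : symbol m u ->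
  exists2 C, 0 <= C & forall x, norm_der j u x <= C * decay x ^+ (m + j).
Proof.
move=> su.
have /choice[C HC] : forall s : j.-tuple 'I_3, exists C, 0 <= C /\
    forall x, `|partials s u x| <= C * decay x ^+ (m + j).
  move=> s; have [C C0 HC] := symbol_bound (symbol_partials s su).
  by exists C; split => // x; rewrite -[X in (m + X)%N](size_tuple s).
exists (\sum_s C s); first by rewrite sumr_ge0// => s _; have [] := HC s.
move=> x; apply: (le_trans (sqrt_sum_sqr_le _)).
by rewrite mulr_suml; apply: ler_sum => s _; have [_] := HC s.
Qed.

Lemma symbol_dist_der m u k : symbol m u ->
  exists2 C, 0 <= C & forall x y, 4 * enorm (x - y) <= weight x ->
    dist_der k u x y <= C * enorm (x - y) * decay x ^+ (m + k).+1.
Proof.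
move=> su.
have /choice[C HC] : forall s : k.-tuple 'I_3, exists C, 0 <= C /\
    forall x y, 4 * enorm (x - y) <= weight x ->
    `|partials s u x - partials s u y| <= C * enorm (x - y) * decay x ^+ (m + k).+1.
  move=> s; have [C C0 HC] := symbol_lipschitz (symbol_partials s su).
  by exists C; split => // x y xy; rewrite -[X in (m + X)%N](size_tuple s) HC.
exists (\sum_s C s); first by rewrite sumr_ge0// => s _; have [] := HC s.
move=> x y xy; apply: (le_trans (sqrt_sum_sqr_le _)).
by rewrite -mulrA mulr_suml; apply: ler_sum => s _; rewrite mulrA; have [_] := HC s; exact.
Qed.

Let weight_decay m x : weight x ^+ m * decay x ^+ m = 1.
Proof. by rewrite -exprMn divff ?expr1n// gt_eqF// weight_gt0. Qed.

(** The Hoelder quotient is interpolated from the Lipschitz one: in |x - y| = |x - y|^(1 - alpha) |x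
    - y|^alpha the first factor is at most weight^(1 - alpha) on admissible pairs. Together with
    weight^(m + k + alpha) it makes up weight^(m + k + 1), exactly the decay of the Lipschitz
    constant. *)
Lemma symbol_weighted_holder D k (alpha : R) m u : 0 < alpha < 1 -> symbol m u ->
  weighted_holder D k alpha m%:R u.
Proof.
move=> /andP[a0 a1] su; split; first exact: symbol_Ck_on su.
have w0 x := weight_gt0 x.
apply: lte_add_pinfty.
  apply: lte_sum_pinfty => j _.
  have [C C0 HC] := symbol_norm_der j su.
  apply: (@le_lt_trans _ _ C%:E); last exact: ltry.
  apply/ereal_supP => _ [x _ <-]; rewrite lee_fin -natrD powR_mulrn; last exact: ltW.
  apply: (@le_trans _ _ (weight x ^+ (m + j) * (C * decay x ^+ (m + j)))).
    by rewrite ler_wpM2l// exprn_ge0// ltW.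
  by rewrite mulrCA weight_decay mulr1.
have [C C0 HC] := symbol_dist_der k su.
apply: (@le_lt_trans _ _ C%:E); last exact: ltry.
apply/ereal_supP => _ [[x y] /= [_ [_ /andP[xy0 xy]]] <-].
have e0 : 0 < enorm (x - y) by move: xy0; rewrite pmulr_rgt0.
rewrite lee_fin -natrD.
set n := (m + k)%N; set e := enorm (x - y) in e0 xy *.
have ea0 : 0 < e `^ alpha by rewrite powR_gt0.
have wn : weight x `^ (n%:R + alpha) = weight x ^+ n * weight x `^ alpha.
  by rewrite powRD ?(gt_eqF (w0 x)) ?implybT// powR_mulrn// ltW.
have e1 : e = e `^ (1 - alpha) * e `^ alpha.
  by rewrite -powRD ?(gt_eqF e0) ?implybT// subrK powRr1// ltW.
have w1 : weight x = weight x `^ (1 - alpha) * weight x `^ alpha.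
  by rewrite -powRD ?(gt_eqF (w0 x)) ?implybT// subrK powRr1// ltW.
have ew : e `^ (1 - alpha) <= weight x `^ (1 - alpha).
  by rewrite ge0_ler_powR ?nnegrE ?subr_ge0 ?ltW//; lra.
rewrite wn.
have wa0 : 0 <= weight x `^ alpha by exact: powR_ge0.
apply: (@le_trans _ _ (weight x ^+ n * weight x `^ alpha *
    (C * e * decay x ^+ n.+1 / e `^ alpha))).
  apply: ler_wpM2l; first by rewrite mulr_ge0// exprn_ge0// ltW.
  by rewrite ler_pM2r ?invr_gt0// HC.
have -> : C * e * decay x ^+ n.+1 / e `^ alpha =
    C * e `^ (1 - alpha) * decay x ^+ n.+1.
  rewrite [X in C * X]e1; field; exact: lt0r_neq0.
apply: (@le_trans _ _ (weight x ^+ n * weight x `^ alpha *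
    (C * weight x `^ (1 - alpha) * decay x ^+ n.+1))).
  apply: ler_wpM2l; first by rewrite mulr_ge0// exprn_ge0// ltW.
  apply: ler_wpM2r; first by rewrite exprn_ge0// ltW// decay_gt0.
  by rewrite ler_wpM2l.
rewrite [leLHS](_ : _ = C * (weight x ^+ n.+1 * decay x ^+ n.+1)).
  by rewrite weight_decay mulr1.
have -> : weight x ^+ n.+1 = weight x ^+ n * (weight x `^ (1 - alpha) * weight x `^ alpha).
  by rewrite -w1 exprSr.
by ring.
Qed.

End WeightedHolder.

(** * De Sitter spacetime is vacuum *)

Section Vacuum.
Context {R : realType}.
Variables (lam Lam : R).
Hypotheses (lam_gt0 : 0 < lam) (LamE : Lam = 3 / lam ^+ 2).
Implicit Types (p : 'rV[R]_4) (i j k l : 'I_4).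

Let e p : R := expR (2 * p 0 0 / lam).
Let lam0 : lam != 0. Proof. exact: lt0r_neq0. Qed.

Lemma deSitterE p i j :
  deSitter lam p i j = (i == j)%:R * (if i == 0 then -1 else e p).
Proof. by rewrite !mxE mulrb; case: (i == j); rewrite ?mul1r ?mul0r. Qed.

Lemma invmx_deSitter p i j :
  invmx (deSitter lam p) i j = (i == j)%:R * (if i == 0 then -1 else (e p)^-1).
Proof.
have e0 : e p != 0 by rewrite gt_eqF// expR_gt0.
suff -> : invmx (deSitter lam p) =
    diag_mx (\row_a (if a == 0 then -1 else (e p)^-1)).
  by rewrite !mxE mulrb; case: (i == j); rewrite ?mul1r ?mul0r.
rewrite -[RHS]mul1mx -(mulVmx (deSitter_unit lam p)) -mulmxA mulmx_diag.
rewrite -[LHS]mulmx1; congr (_ *m _); apply/matrixP => a b; rewrite !mxE.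
case: (a == b); rewrite ?mulr0n// mulr1n.
by case: ifP => _; rewrite ?mulrNN ?mulr1// divff.
Qed.

Lemma differentiable_exp_time p : differentiable e p.
Proof.
apply: (@differentiable_scalar_comp _ _ expR (fun q : 'rV[R]_4 => 2 * q 0 0 / lam)).
have d : differentiable (fun q : 'rV[R]_4 => q 0 0) p by exact: differentiable_coord.
have d2 : differentiable (fun q : 'rV[R]_4 => 2 * q 0 0) p.
  by apply: differentiableM => //; exact: differentiable_cst.
by apply: differentiableM => //; exact: differentiable_cst.
Qed.

Lemma partial_exp_time i p : partial i e p = (i == 0)%:R * (2 / lam) * e p.
Proof.
have d : differentiable (fun q : 'rV[R]_4 => q 0 0) p by exact: differentiable_coord.
have d2 : differentiable (fun q : 'rV[R]_4 => 2 / lam * q 0 0) p.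
  by apply: differentiableM => //; exact: differentiable_cst.
rewrite (_ : e = fun q => expR (2 / lam * q 0 0)); last first.
  by apply/funext => q; rewrite /e mulrAC.
rewrite (partial_comp i (is_derive_expR _) d2) partialMl// partial_coordinate.
by ring.
Qed.

Lemma partial_scaled_exp_time i (c d : R) p :
  partial i (fun q => c + d * e q) p = d * ((i == 0)%:R * (2 / lam) * e p).
Proof.
have de := differentiable_exp_time p.
have dc : differentiable (fun=> c : R) p by exact: differentiable_cst.
have dd : differentiable (fun q => d * e q) p.
  by apply: differentiableM => //; exact: differentiable_cst.
by rewrite (partialD i dc dd) partial_cst add0r partialMl// partial_exp_time.
Qed.

Lemma partial_deSitter i j k p : partial i (fun q => deSitter lam q j k) p =
  ((i == 0) && (j == k) && (j != 0))%:R * (2 / lam) * e p.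
Proof.
rewrite (_ : (fun q => _) = fun q => (if (j == k) && (j == 0) then -1 else 0)
    + ((j == k) && (j != 0))%:R * e q); last first.
  apply/funext => q; rewrite deSitterE.
  by case: (j == k); case: (j == 0); rewrite /= ?mul1r ?mul0r ?addr0 ?add0r.
rewrite partial_scaled_exp_time.
by case: (i == 0); case: (j == k); case: (j == 0); rewrite /= ?mul1r ?mul0r ?mulr0.
Qed.

(** For k spatial, the nonzero symbols are Gamma^k_(0k) = Gamma^k_(k0) = 1 / lam and Gamma^0_(kk) =
    e / lam. The shape constant plus constant times [e] lets [partial_scaled_exp_time] differentiate
    them at once. *)
Lemma christoffel_deSitter k i j : christoffel (deSitter lam) k i j =
  fun p => (((i == 0) && (j == k) && (j != 0))%:R
            + ((j == 0) && (i == k) && (i != 0))%:R) / lam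
           + ((k == 0) && (i == j) && (i != 0))%:R / lam * e p.
Proof.
apply/funext => p; rewrite /christoffel.
have e0 : e p != 0 by rewrite gt_eqF// expR_gt0.
rewrite (bigD1 k)//= big1 ?addr0; last first.
  by move=> l lk; rewrite invmx_deSitter eq_sym (negbTE lk) !mul0r.
rewrite invmx_deSitter !partial_deSitter eqxx mul1r.
have [->|k0] := eqVneq k 0.
  by rewrite -!andbA !andbN !andbF /=; field.
by rewrite !andFb /=; field; apply/andP.
Qed.

Lemma ricci_deSitter p : ricci (deSitter lam) p = Lam *: deSitter lam p.
Proof.
apply/matrixP => i j; rewrite mxE [RHS]mxE deSitterE.
under eq_bigr => k _.
  rewrite !christoffel_deSitter !partial_scaled_exp_time.
  under eq_bigr do rewrite !christoffel_deSitter.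
  over.
rewrite LamE.
case: i => [[|[|[|[|//]]]] lti]; case: j => [[|[|[|[|//]]]] ltj];
  rewrite !big_ord_recl !big_ord0 /= ?(mulr0n, mulr1n, mul0r, mul1r, mulr0, addr0, add0r, subr0).
all: by field.
Qed.

(** Ric = Lam g has scalar curvature 4 Lam in dimension 4, and Lam - 2 Lam + Lam = 0. *)
Lemma energy_momentum_deSitter p : energy_momentum Lam (deSitter lam) p = 0.
Proof.
rewrite /energy_momentum /scalar_curv /mtrace ricci_deSitter.
rewrite -scalemxAr mulVmx ?deSitter_unit// mxtraceZ mxtrace1 -scalerBl -scalerDl.
by rewrite (_ : _ + Lam = 0) ?scale0r ?scaler0//; field.
Qed.

Lemma momentum_density_deSitter f x : momentum_density Lam (deSitter lam) f x = 0.
Proof. by rewrite /momentum_density energy_momentum_deSitter mulmx0 mul0mx. Qed.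

End Vacuum.

(** * Graphs in de Sitter spacetime *)

Section GraphHypersurface.
Context {R : realType}.
Implicit Types (f : 'rV[R]_3 -> R) (x : 'rV[R]_3) (i j k : 'I_3).

(** These two identities pass between the block indices of 1 + 3 and the ordinals of 4 produced by
    [big_ord_recl]. *)
Let lshift0 : lshift 3 (0 : 'I_1) = (0 : 'I_4). Proof. exact/val_inj. Qed.
Let rshift1 k : rshift 1 k = lift (0 : 'I_4) k :> 'I_4. Proof. exact/val_inj. Qed.

Lemma graph_time f x : graph f x 0 0 = f x.
Proof. by rewrite -lshift0 /graph (@row_mxEl _ 1 1 3) !mxE eqxx. Qed.

Lemma graph_space f x k : graph f x 0 (lift 0 k) = x 0 k.
Proof. by rewrite -rshift1 /graph (@row_mxEr _ 1 1 3). Qed.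

Lemma tangents_time f x i : tangents (graph f) x i 0 = partial i f x.
Proof. by rewrite mxE; congr partial; apply/funext => y; exact: graph_time. Qed.

Lemma tangents_space f x i k : tangents (graph f) x i (lift 0 k) = (i == k)%:R.
Proof.
rewrite mxE -(partial_coord i k x); congr partial.
by apply/funext => y; exact: graph_space.
Qed.

Lemma conormal_time f x : conormal f x 0 0 = 1.
Proof. by rewrite -lshift0 /conormal (@row_mxEl _ 1 1 3) !mxE eqxx. Qed.

Lemma conormal_space f x k : conormal f x 0 (lift 0 k) = - partial k f x.
Proof. by rewrite -rshift1 /conormal (@row_mxEr _ 1 1 3) !mxE. Qed.

Lemma spatial_graph f x : spatial (graph f x) = x.
Proof. by rewrite /spatial /graph row_mxKr. Qed.

Lemma spatialE (p : 'rV[R]_4) k : spatial p 0 k = p 0 (lift 0 k).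
Proof. by rewrite /spatial !mxE rshift1. Qed.

(** Used with [partial_spatial_space] to differentiate the t-independent extension of the normal.
    Time does not move the spatial part, so the difference quotient is identically 0. *)
Lemma partial_spatial_time (u : 'rV[R]_3 -> R) (p : 'rV[R]_4) :
  partial 0 (fun q => u (spatial q)) p = 0.
Proof.
rewrite /partial /derive.
rewrite (_ : (fun h : R => _) = fun=> 0); first exact: lim_cst.
apply/funext => h /=; rewrite (_ : spatial (h *: _ + p) = spatial p) ?subrr ?scaler0//.
by apply/rowP => k; rewrite !spatialE !mxE /= mulr0 add0r.
Qed.

Lemma partial_spatial_space (u : 'rV[R]_3 -> R) (p : 'rV[R]_4) i :
  partial (lift 0 i) (fun q => u (spatial q)) p = partial i u (spatial p).
Proof.
have E (h : R) : spatial (h *: delta_mx 0 (lift 0 i) + p) =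
    h *: delta_mx 0 i + spatial p.
  by apply/rowP => k; rewrite spatialE !mxE rshift1 (inj_eq lift_inj).
rewrite /partial /derive.
rewrite (_ : (fun h : R => _) = fun h : R => h^-1 *:
  ((u \o shift (spatial p)) (h *: delta_mx 0 i) - u (spatial p)))//.
by apply/funext => h /=; rewrite E.
Qed.

(** Pullback of a bilinear form along d_i F = (d_i f) e_0 + e_i; it serves the metric and its Lie
    derivative alike. *)
Lemma tangents_bilinear f x (B : 'M[R]_4) i j :
  (tangents (graph f) x *m B *m (tangents (graph f) x)^T) i j =
  partial i f x * partial j f x * B 0 0 + partial i f x * B 0 (lift 0 j)
  + partial j f x * B (lift 0 i) 0 + B (lift 0 i) (lift 0 j).
Proof.
have TB (b : 'I_4) : (tangents (graph f) x *m B) i b =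
    partial i f x * B 0 b + B (lift 0 i) b.
  rewrite mxE big_ord_recl tangents_time; congr (_ + _).
  under eq_bigr do rewrite tangents_space.
  exact: sum_delta.
rewrite mxE big_ord_recl TB [_^T _ _]mxE tangents_time.
under eq_bigr do rewrite TB mxE tangents_space mulrC.
by rewrite sum_delta; ring.
Qed.

Variable lam : R.

Let dS0 p k : deSitter lam p 0 (lift 0 k) = 0.
Proof. by rewrite deSitterE mul0r. Qed.

Let dS0' p k : deSitter lam p (lift 0 k) 0 = 0.
Proof. by rewrite deSitterE mul0r. Qed.

Lemma induced_metric_deSitter f x i j : induced_metric (deSitter lam) f x i j =
  expR (2 * f x / lam) * (i == j)%:R - partial i f x * partial j f x.
Proof.
rewrite tangents_bilinear dS0 dS0' !deSitterE graph_time /=.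
by rewrite (inj_eq lift_inj); ring.
Qed.

(** The squared length of df in the slice metric a delta; the graph is spacelike where it is below
    1. *)
Definition slope f x : R := (expR (2 * f x / lam))^-1 * \sum_i partial i f x ^+ 2.

(** The Lorentz factor of the unit normal relative to d/dt. *)
Definition tilt f x : R := (Num.sqrt (1 - slope f x))^-1.

Let conormal_raised_time f x :
  (conormal f x *m invmx (deSitter lam (graph f x))) 0 0 = -1.
Proof.
rewrite mxE big_ord_recl big1 ?addr0.
  by rewrite conormal_time invmx_deSitter /= mul1r mulr1n mul1r.
by move=> k _; rewrite invmx_deSitter mul0r mulr0.
Qed.

Let conormal_raised_space f x k :
  (conormal f x *m invmx (deSitter lam (graph f x))) 0 (lift 0 k) =
  - ((expR (2 * f x / lam))^-1 * partial k f x).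
Proof.
rewrite mxE big_ord_recl (bigD1 k)//= big1 ?addr0.
  rewrite conormal_space !invmx_deSitter /= mul0r mulr0 add0r eqxx graph_time.
  by rewrite mulr1n mul1r; ring.
by move=> l lk; rewrite invmx_deSitter (inj_eq lift_inj) (negbTE lk) mul0r mulr0.
Qed.

Let conormal_norm f x :
  - (conormal f x *m invmx (deSitter lam (graph f x)) *m (conormal f x)^T) 0 0 =
  1 - slope f x.
Proof.
rewrite mxE big_ord_recl [_^T _ _]mxE conormal_time conormal_raised_time mulr1.
rewrite opprD opprK; congr (_ - _).
rewrite /slope mulr_sumr; apply: eq_bigr => k _.
by rewrite [_^T _ _]mxE conormal_space conormal_raised_space; ring.
Qed.

Lemma unit_normal_time f x : unit_normal (deSitter lam) f x 0 0 = tilt f x.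
Proof. by rewrite /unit_normal conormal_norm mxE conormal_raised_time mulrN1 opprK. Qed.

Lemma unit_normal_space f x k : unit_normal (deSitter lam) f x 0 (lift 0 k) =
  tilt f x * ((expR (2 * f x / lam))^-1 * partial k f x).
Proof. by rewrite /unit_normal conormal_norm mxE conormal_raised_space mulrNN. Qed.

Lemma lie_metric_deSitter_time N p :
  lie_metric (deSitter lam) N p 0 0 = - 2 * partial 0 (fun q => N q 0 0) p.
Proof.
rewrite mxE big_ord_recl big1 ?addr0; last first.
  by move=> l _; rewrite partial_deSitter dS0 dS0' /=; ring.
rewrite partial_deSitter deSitterE /=; ring.
Qed.

Lemma lie_metric_deSitter_mixed N p k :
  lie_metric (deSitter lam) N p 0 (lift 0 k) =
  - partial (lift 0 k) (fun q => N q 0 0) p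
  + expR (2 * p 0 0 / lam) * partial 0 (fun q => N q 0 (lift 0 k)) p.
Proof.
rewrite mxE big_ord_recl (bigD1 k)//= big1 ?addr0; last first.
  move=> l lk; rewrite partial_deSitter dS0 deSitterE (inj_eq lift_inj) (negbTE lk) /=.
  by ring.
by rewrite !partial_deSitter !dS0 !deSitterE (inj_eq lift_inj) /= eqxx /= ?mulr1n; ring.
Qed.

Lemma lie_metric_sym st N (p : 'rV[R]_4) a b : (forall q, (st q)^T = st q) ->
  lie_metric st N p a b = lie_metric st N p b a.
Proof.
move=> sts; rewrite !mxE; apply: eq_bigr => c _.
have E d e q : st q d e = st q e d by rewrite -[in LHS]sts mxE.
rewrite (E c b) (E a c).
have -> : (fun y => st y a b) = (fun y => st y b a) by apply/funext => y; exact: E.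
by ring.
Qed.

Lemma lie_metric_deSitter_space N p k l :
  lie_metric (deSitter lam) N p (lift 0 k) (lift 0 l) =
  expR (2 * p 0 0 / lam) *
  (N p 0 0 * (2 / lam) * (k == l)%:R
   + partial (lift 0 k) (fun q => N q 0 (lift 0 l)) p
   + partial (lift 0 l) (fun q => N q 0 (lift 0 k)) p).
Proof.
rewrite mxE !big_split/= !mulrDr; congr (_ + _ + _).
- rewrite big_ord_recl big1 ?addr0.
    by rewrite partial_deSitter (inj_eq lift_inj) /= andbT; ring.
  by move=> m _; rewrite partial_deSitter /= !mul0r mulr0.
- rewrite big_ord_recl dS0 mul0r add0r (bigD1 l)//= big1 ?addr0.
    by rewrite deSitterE eqxx mul1r.
  by move=> m ml; rewrite deSitterE (inj_eq lift_inj) (negbTE ml) !mul0r.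
- rewrite big_ord_recl dS0' mul0r add0r (bigD1 k)//= big1 ?addr0.
    by rewrite deSitterE eqxx mul1r.
  by move=> m mk; rewrite deSitterE (inj_eq lift_inj) eq_sym (negbTE mk) !mul0r.
Qed.

(* Sherman-Morrison *)
Lemma invmx_induced_metric f x : slope f x != 1 ->
  invmx (induced_metric (deSitter lam) f x) =
  \matrix_(i, j) ((expR (2 * f x / lam))^-1 * ((i == j)%:R
     + (1 - slope f x)^-1 * (expR (2 * f x / lam))^-1 * partial i f x * partial j f x)).
Proof.
move=> s1; set G := \matrix_(i, j) _; set g := induced_metric _ _ _.
have a0 := lt0r_neq0 (expR_gt0 (2 * f x / lam)).
have s10 : 1 - slope f x != 0 by rewrite subr_eq0 eq_sym.
have gG : g *m G = 1%:M.
  apply/matrixP => i j; rewrite !mxE.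
  pose v k := partial k f x.
  have -> : \sum_k g i k * G k j = \sum_k ((i == k)%:R * (expR (2 * f x / lam) * G k j)
      - v i * (v k * G k j)).
    by apply: eq_bigr => k _; rewrite /g induced_metric_deSitter /v; ring.
  rewrite sumrB sum_delta -mulr_sumr.
  have -> : \sum_k v k * G k j =
      (expR (2 * f x / lam))^-1 * (v j + (1 - slope f x)^-1 * slope f x * v j).
    transitivity (\sum_k ((j == k)%:R * ((expR (2 * f x / lam))^-1 * v k) +
       (expR (2 * f x / lam))^-1 * (1 - slope f x)^-1 * v j *
       ((expR (2 * f x / lam))^-1 * v k ^+ 2))).
      by apply: eq_bigr => k _; rewrite mxE /v eq_sym; ring.
    rewrite big_split/= sum_delta -mulr_sumr -mulr_sumr -/(slope f x).
    by rewrite /slope -/v; ring.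
  rewrite mxE -/(v i) -/(v j); field; by rewrite s10 a0.
have [_ gu] := mulmx1_unit gG.
have ug : g \in unitmx by have [] := mulmx1_unit gG.
by rewrite -[RHS]mul1mx -(mulVmx ug) -mulmxA gG mulmx1.
Qed.

End GraphHypersurface.

(** * Second fundamental form of a graph in de Sitter spacetime *)

Section SecondFundamentalForm.
Context {R : realType}.
Variable lam : R.
Implicit Types (f : 'rV[R]_3 -> R) (x : 'rV[R]_3) (i j k : 'I_3).

Let differentiable_expM (c : R) f (y : 'rV[R]_3) : differentiable f y ->
  differentiable (fun z => c * f z) y /\ differentiable (fun z => expR (c * f z)) y.
Proof.
move=> df; have dc : differentiable (fun z => c * f z) y.
  by apply: differentiableM => //; exact: differentiable_cst.
by split => //; apply: (@differentiable_scalar_comp _ _ expR (fun z => c * f z)).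
Qed.

Lemma partial_unit_normal_space f x k l : differentiable f x ->
  differentiable (partial l f) x -> differentiable (tilt lam f) x ->
  partial k (fun y => unit_normal (deSitter lam) f y 0 (lift 0 l)) x =
  (expR (2 * f x / lam))^-1 *
  (partial k (tilt lam f) x * partial l f x +
   tilt lam f x * (partial k (partial l f) x - 2 / lam * partial k f x * partial l f x)).
Proof.
move=> df ddf dV.
have -> : (fun y => unit_normal (deSitter lam) f y 0 (lift 0 l)) =
    fun y => tilt lam f y * (expR (- (2 / lam) * f y) * partial l f y).
  apply/funext => y; rewrite unit_normal_space -expRN; congr (_ * (expR _ * _)).
  by rewrite mulNr mulrAC.
have [dc dE] := differentiable_expM (- (2 / lam)) df.
have dEd : differentiable (fun y => expR (- (2 / lam) * f y) * partial l f y) x.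
  exact: (differentiableM dE ddf).
rewrite (partialM k dV dEd) (partialM k dE ddf).
rewrite (partial_comp k (is_derive_expR _) dc) partialMl//.
have -> : expR (- (2 / lam) * f x) = (expR (2 * f x / lam))^-1.
  by rewrite -expRN mulNr mulrAC.
move: (expR _)^-1 (partial k (partial l f) x) (partial k (tilt lam f) x) (tilt lam f x).
by move: (partial k f x) (partial l f x) => *; ring.
Qed.

(* The derivatives of the normal along the graph combine so that no derivative of the tilt survives. *)
Lemma second_ff_deSitter f x i j :
  differentiable f x -> (forall k, differentiable (partial k f) x) ->
  differentiable (tilt lam f) x -> partial i (partial j f) x = partial j (partial i f) x ->
  second_ff (deSitter lam) f x i j =
  tilt lam f x * (partial i (partial j f) x + expR (2 * f x / lam) / lam * (i == j)%:R
              - 2 / lam * partial i f x * partial j f x).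
Proof.
move=> df ddf dV sym.
rewrite /second_ff mxE tangents_bilinear.
rewrite lie_metric_deSitter_time lie_metric_deSitter_mixed.
rewrite (@lie_metric_sym _ _ _ _ (lift 0 i)); last by move=> q; rewrite /deSitter tr_diag_mx.
rewrite lie_metric_deSitter_mixed lie_metric_deSitter_space graph_time.
have Nt (k : 'I_4) : partial 0 (fun q => normal_ext (deSitter lam) f q 0 k) (graph f x) = 0.
  exact: (partial_spatial_time (fun y => unit_normal (deSitter lam) f y 0 k)).
have N0 k : partial (lift 0 k) (fun q => normal_ext (deSitter lam) f q 0 0) (graph f x) =
    partial k (tilt lam f) x.
  rewrite (partial_spatial_space (fun y => unit_normal (deSitter lam) f y 0 0)).
  by rewrite spatial_graph; congr partial; apply/funext => y; exact: unit_normal_time.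
have Ns k l : partial (lift 0 k) (fun q => normal_ext (deSitter lam) f q 0 (lift 0 l))
    (graph f x) = (expR (2 * f x / lam))^-1 *
      (partial k (tilt lam f) x * partial l f x +
       tilt lam f x * (partial k (partial l f) x - 2 / lam * partial k f x * partial l f x)).
  rewrite (partial_spatial_space (fun y => unit_normal (deSitter lam) f y 0 (lift 0 l))).
  by rewrite spatial_graph partial_unit_normal_space.
rewrite !Nt !N0 !Ns -sym.
have -> : normal_ext (deSitter lam) f (graph f x) 0 0 = tilt lam f x.
  by rewrite /normal_ext spatial_graph unit_normal_time.
have a0 := lt0r_neq0 (expR_gt0 (2 * f x / lam)).
move: a0; move: (expR _) => a a0.
move: (partial i (partial j f) x) (partial i (tilt lam f) x) (partial j (tilt lam f) x).
move: (partial i f x) (partial j f x) (tilt lam f x) (lam^-1) ((i == j)%:R).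
by move=> *; field.
Qed.

End SecondFundamentalForm.

(** * The perturbed slice *)

(** Cauchy-Schwarz, obtained from Lagrange's identity, bounds the form a |v|^2 - (d . v)^2 below by
    (a - |d|^2) |v|^2. *)
Lemma pos_def_rank_one_update {R : realType} (a : R) (d : 'I_3 -> R) (b : 'M[R]_3) :
  (forall i j, b i j = a * (i == j)%:R - d i * d j) -> \sum_i d i ^+ 2 < a -> pos_def b.
Proof.
move=> bE da; split.
  by apply/matrixP => i j; rewrite mxE !bE eq_sym mulrC; congr (_ - _); rewrite mulrC.
move=> v v0.
have gE : (v *m b *m v^T) 0 0 = a * \sum_i v 0 i ^+ 2 - (\sum_i d i * v 0 i) ^+ 2.
  rewrite mxE; under eq_bigr do rewrite mxE [v^T _ _]mxE.
  rewrite !big_ord_recl !big_ord0 !bE /= ?(mulr1n, mulr0n).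
  move: (d _) (d _) (d _) (v 0 _) (v 0 _) (v 0 _) => d0 d1 d2 v1 v2 v3; ring.
have vpos : 0 < \sum_i v 0 i ^+ 2.
  rewrite lt_neqAle sumr_ge0 ?andbT; last by move=> i _; exact: sqr_ge0.
  apply: contra v0; rewrite eq_sym psumr_eq0; last by move=> i _; exact: sqr_ge0.
  move=> /allP h; apply/eqP/rowP => i; rewrite mxE; apply/eqP.
  by have := h i (mem_index_enum i); rewrite sqrf_eq0.
have CS : (\sum_i d i * v 0 i) ^+ 2 <= (\sum_i d i ^+ 2) * \sum_i v 0 i ^+ 2.
  rewrite !big_ord_recl !big_ord0 !addr0.
  move: (d _) (d _) (d _) (v 0 _) (v 0 _) (v 0 _) => d0 d1 d2 v1 v2 v3.
  rewrite -subr_ge0 (_ : _ - _ = (d0 * v2 - d1 * v1) ^+ 2 + (d0 * v3 - d2 * v1) ^+ 2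
     + (d1 * v3 - d2 * v2) ^+ 2); last by ring.
  by rewrite !addr_ge0// sqr_ge0.
rewrite gE; apply: (lt_le_trans _ (lerB (lexx _) CS)).
by rewrite -mulrBl mulr_gt0// subr_gt0.
Qed.

Section PerturbedSlice.
Context {R : realType}.
Variables (lam t0 eps : R).
Hypothesis lam_gt0 : 0 < lam.
Implicit Types (x : 'rV[R]_3) (i j k : 'I_3).

Notation st := (deSitter lam).
Notation f := (perturbed_time t0 eps).
Notation P := (expR (t0 / lam)).
Notation c := (2 * eps / lam).
Notation s := decay.
Notation p := dirn.

Lemma perturbed_timeE : f = fun x : 'rV[R]_3 => t0 + eps * s x.
Proof.
apply/funext => x; rewrite /perturbed_time powRN powR12_sqrt//.
by rewrite addr_ge0// sqr_ge0.
Qed.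

Lemma differentiable_perturbed_time x : differentiable f x.
Proof.
rewrite perturbed_timeE; apply: differentiableD; first exact: differentiable_cst.
apply: differentiableM; first exact: differentiable_cst.
exact: differentiable_decay.
Qed.

Lemma partial_perturbed_time i : partial i f = fun x => - eps * (s x ^+ 2 * p i x).
Proof.
apply/funext => x; rewrite perturbed_timeE.
have dc : differentiable (fun=> t0) x by exact: differentiable_cst.
have dd := @differentiable_decay R x.
have de : differentiable (fun y => eps * s y) x.
  by apply: differentiableM => //; exact: differentiable_cst.
by rewrite (partialD i dc de) partial_cst partialMl// partial_decay; ring.
Qed.

Lemma symbol_decay_dirn n i : symbol n (fun x : 'rV[R]_3 => s x ^+ n * p i x).
Proof.
have := symbolM (symbol_decayX n) (@symbol_dirn R i).
by rewrite addn0.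
Qed.

Lemma symbol_decay_dirn2 n i j : symbol n (fun x : 'rV[R]_3 => s x ^+ n * p i x * p j x).
Proof.
have := symbolM (symbol_decay_dirn n i) (@symbol_dirn R j).
by rewrite addn0.
Qed.

Lemma symbol_partial_perturbed_time i : symbol 2 (partial i f).
Proof. by rewrite partial_perturbed_time; apply: symbolMl; exact: symbol_decay_dirn. Qed.

Lemma partial2_perturbed_time i j : partial i (partial j f) =
  fun x => eps * (s x ^+ 3 * (3 * p i x * p j x - (i == j)%:R)).
Proof.
apply/funext => x; rewrite (_ : partial j f = fun y => eps * partial j (@decay R) y).
  rewrite partialMl ?partial2_decay//.
  exact: (symbol_differentiable _ (symbol_partial j symbol_decay)).
by apply/funext => y; rewrite partial_perturbed_time partial_decay; ring.
Qed.

(** Separates the value P^2 of the conformal factor at infinity from a factor tending to 1; this is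
    where the constant P of the asymptotics comes from. *)
Lemma exp_perturbed_time x : expR (2 * f x / lam) = P ^+ 2 * expdecay c x.
Proof.
rewrite perturbed_timeE /expdecay expr2 -!expRD; congr expR.
by field; exact: lt0r_neq0.
Qed.

Lemma expdecayN (d : R) x : (expdecay d x)^-1 = expdecay (- d) x.
Proof. by rewrite /expdecay mulNr expRN. Qed.

Lemma slope_perturbed_time x : slope lam f x =
  P ^- 2 * eps ^+ 2 * (expdecay (- c) x * (s x ^+ 4 * (1 - s x ^+ 2))).
Proof.
rewrite /slope exp_perturbed_time -expdecayN invfM -dirn_sqr_sum !mulr_sumr.
by apply: eq_bigr => i _; rewrite partial_perturbed_time; ring.
Qed.

Lemma symbol_slope : symbol 4 (slope lam f).
Proof.
rewrite (_ : slope lam f = fun x => P ^- 2 * eps ^+ 2 *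
    (expdecay (- c) x * (s x ^+ 4 * (1 - s x ^+ 2)))); last first.
  by apply/funext => x; exact: slope_perturbed_time.
apply: symbolMl; apply: (symbolM (m1 := 0)); first exact: symbol_expdecay.
apply: (symbolM (m1 := 4) (m2 := 0)); first exact: symbol_decayX.
apply: symbolB; first exact: symbol_cst.
by apply: (@symbol_le _ 2) => //; exact: symbol_decayX.
Qed.

Lemma slope_ge0 x : 0 <= slope lam f x.
Proof.
rewrite /slope mulr_ge0 ?invr_ge0 ?expR_ge0// sumr_ge0// => i _; exact: sqr_ge0.
Qed.

Lemma embedding_graph : embedding (graph f).
Proof.
have sf : symbol 0 f.
  rewrite perturbed_timeE; apply: symbolD; first exact: symbol_cst.
  apply: symbolMl; apply: (@symbol_le _ 1) => //; exact: symbol_decay.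
split.
- move=> a k; have [l ->|->] := unliftP 0 a; last first.
    rewrite (_ : (fun x => _) = f); first exact: symbol_Ck_on sf.
    by apply/funext => x; rewrite graph_time.
  (* Coordinates grow at infinity and are not symbols of order 0, so their smoothness is checked
     directly: the first partials are constant. *)
  rewrite (_ : (fun x => _) = fun x => x 0 l); last first.
    by apply/funext => x; rewrite graph_space.
  have dc x : differentiable (fun y : 'rV[R]_3 => y 0 l) x by exact: differentiable_coord.
  case: k => [|k]; first by split => // x _; exact: differentiable_continuous.
  split => [x _|i]; first exact: differentiable_continuous.
  split; first by move=> x _; exact: diff_derivable.
  by rewrite partial_coordinate; apply: symbol_Ck_on; exact: symbol_cst.
- by move=> x y /(congr1 spatial); rewrite !spatial_graph.
(* The identity block of the tangent matrix provides a right inverse. *)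
- move=> x; apply/row_freeP; exists (col_mx 0 1%:M : 'M[R]_(1 + 3, 3)).
  by rewrite tangents_graph (@mul_row_col _ 3 1 3) mulmx0 add0r mulmx1.
(* The projection to space is a continuous left inverse of the graph map. *)
- move=> U oU; exists (spatial @^-1` U); split.
    apply: open_comp => // q _.
    exact: (@continuous_rsubmx R 1 1 3).
  by apply/seteqP; split => x; rewrite /= spatial_graph.
Qed.

Lemma induced_metric_perturbed x i j : induced_metric st f x i j =
  P ^+ 2 * expdecay c x * (i == j)%:R - eps ^+ 2 * s x ^+ 4 * p i x * p j x.
Proof.
rewrite induced_metric_deSitter exp_perturbed_time !partial_perturbed_time.
by ring.
Qed.

Hypothesis slope_le : forall x, slope lam f x <= 2^-1.

Let slope_lt1 x : 0 < 1 - slope lam f x.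
Proof. by have := slope_le x; lra. Qed.

Lemma spacelike_perturbed : spacelike st f.
Proof.
move=> x; apply: (@pos_def_rank_one_update _ (expR (2 * f x / lam)) (fun i => partial i f x)).
  by move=> i j; rewrite induced_metric_deSitter.
rewrite -subr_gt0.
have -> : \sum_i partial i f x ^+ 2 = expR (2 * f x / lam) * slope lam f x.
  by rewrite /slope mulrA divff ?mul1r// lt0r_neq0// expR_gt0.
by rewrite -[X in X - _]mulr1 -mulrBr mulr_gt0 ?expR_gt0.
Qed.

Lemma symbol_tilt : symbol 0 (tilt lam f) /\ symbol 4 (fun x => tilt lam f x - 1).
Proof. exact: symbol_invsqrt symbol_slope slope_le. Qed.

Lemma tilt_sqr x : tilt lam f x ^+ 2 * (1 - slope lam f x) = 1.
Proof. by rewrite /tilt exprVn sqr_sqrtr ?ltW// mulVf// lt0r_neq0. Qed.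

Lemma tilt_gt0 x : 0 < tilt lam f x.
Proof. by rewrite invr_gt0 sqrtr_gt0. Qed.

Lemma second_ff_perturbed x i j : second_ff st f x i j =
  tilt lam f x * (eps * (s x ^+ 3 * (3 * p i x * p j x - (i == j)%:R))
    + P ^+ 2 * expdecay c x / lam * (i == j)%:R
    - 2 / lam * (eps ^+ 2 * s x ^+ 4 * p i x * p j x)).
Proof.
rewrite second_ff_deSitter.
- rewrite exp_perturbed_time partial2_perturbed_time !partial_perturbed_time.
  by congr (_ * _); ring.
- exact: differentiable_perturbed_time.
- by move=> k; exact: symbol_differentiable (symbol_partial_perturbed_time k).
- by have [sV _] := symbol_tilt; exact: symbol_differentiable sV.
- by rewrite !partial2_perturbed_time eq_sym; ring.
Qed.

Lemma invmx_induced_metric_perturbed x i j : invmx (induced_metric st f x) i j =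
  P ^- 2 * expdecay (- c) x * (i == j)%:R +
  tilt lam f x ^+ 2 * (P ^- 2 * expdecay (- c) x) ^+ 2 *
    (eps ^+ 2 * s x ^+ 4 * p i x * p j x).
Proof.
rewrite invmx_induced_metric; last by rewrite -subr_eq0 -opprB oppr_eq0 lt0r_neq0.
rewrite mxE exp_perturbed_time !partial_perturbed_time.
have <- : tilt lam f x ^+ 2 = (1 - slope lam f x)^-1.
  by rewrite /tilt exprVn sqr_sqrtr// ltW.
by rewrite -expdecayN invfM; ring.
Qed.

End PerturbedSlice.

(** * Integrals *)

Section ProductIntegrals.
Local Open Scope ereal_scope.
Context {d1 d2 : measure_display} {T1 : measurableType d1} {T2 : measurableType d2}.
Context {R : realType}.
Variables (m1 : {sigma_finite_measure set T1 -> \bar R}).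
Variables (m2 : {sigma_finite_measure set T2 -> \bar R}).
Variables (u : T1 -> R) (v : T2 -> R).
Hypothesis iu : m1.-integrable setT (EFin \o u).
Hypothesis iv : m2.-integrable setT (EFin \o v).

(** Tonelli: the iterated integral of the norm factors into two finite integrals. *)
Lemma integrable_prodM : (m1 \x m2).-integrable setT (fun z => (u z.1 * v z.2)%:E).
Proof.
have mu : measurable_fun setT u by apply/measurable_EFinP; exact: measurable_int iu.
have mv : measurable_fun setT v by apply/measurable_EFinP; exact: measurable_int iv.
have muv : measurable_fun setT (fun z : T1 * T2 => (u z.1 * v z.2)%:E).
  apply/measurable_EFinP; apply: measurable_funM; exact: measurableT_comp.
apply: (proj2 (@integrable12ltyP _ _ _ _ R m1 m2 _ muv)) => /=.
have iau : m1.-integrable setT (EFin \o (Num.norm \o u)) by exact: integrable_norm.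
have iav : m2.-integrable setT (EFin \o (Num.norm \o v)) by exact: integrable_norm.
have iav_fin := integrable_fin_num measurableT iav.
have iau_fin := integrable_fin_num measurableT iau.
have -> : \int[m1]_x \int[m2]_y `|(u x * v y)%:E| =
    (fine (\int[m2]_y (`|v y|%R)%:E))%:E * \int[m1]_x (`|u x|%R)%:E.
  rewrite -(integralZl _ iau)//; apply: eq_integral => x _ /=.
  rewrite (fineK iav_fin) muleC -(integralZl _ iav)//.
  by apply: eq_integral => y _ /=; rewrite normrM EFinM.
by rewrite -(fineK iau_fin) -EFinM ltry.
Qed.

Lemma integral_prodM :
  \int[m1 \x m2]_z (u z.1 * v z.2)%:E = \int[m1]_x (u x)%:E * \int[m2]_y (v y)%:E.
Proof.
rewrite -integral12_prod_meas1; last exact: integrable_prodM.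
have iv_fin := integrable_fin_num measurableT iv.
rewrite -(fineK iv_fin) muleC -(integralZl _ iu)//; apply: eq_integral => x _ /=.
by rewrite /fubini_F (fineK iv_fin) muleC -(integralZl _ iv).
Qed.

End ProductIntegrals.

(* The library's instance on products only covers subprobabilities: its
   sigma-finite one is shadowed. *)
Lemma sigma_finite_prod {d1 d2 : measure_display} {T1 : measurableType d1}
    {T2 : measurableType d2} {R : realType}
    (m1 : {sigma_finite_measure set T1 -> \bar R})
    (m2 : {sigma_finite_measure set T2 -> \bar R}) :
  sigma_finite setT (m1 \x m2)%E.
Proof.
have /sigma_finiteP[F [TF ndF Foo]] := sigma_finiteT m1.
have /sigma_finiteP[G [TG ndG Goo]] := sigma_finiteT m2.
exists (fun n => F n `*` G n).
  apply/esym/seteqP; split => // -[x y] _.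
  have [n _ Fx] : (\bigcup_n F n) x by rewrite -TF.
  have [k _ Gy] : (\bigcup_n G n) y by rewrite -TG.
  exists (maxn n k) => //; split => /=.
    by have /subsetPset := ndF _ _ (leq_maxl n k); apply.
  by have /subsetPset := ndG _ _ (leq_maxr n k); apply.
move=> n; have [mF fF] := Foo n; have [mG fG] := Goo n.
split; first exact: measurableX.
by rewrite product_measure1E// lte_mul_pinfty// ge0_fin_numE.
Qed.

Lemma integrable_le_prodM3 {d1 d2 d3 : measure_display} {T1 : measurableType d1}
    {T2 : measurableType d2} {T3 : measurableType d3} {R : realType}
    (m1 : {sigma_finite_measure set T1 -> \bar R})
    (m2 : {sigma_finite_measure set T2 -> \bar R})
    (m3 : {sigma_finite_measure set T3 -> \bar R})
    (u : T1 -> R) (v : T2 -> R) (w : T3 -> R) (k : R) (F : T1 * (T2 * T3) -> R) :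
  m1.-integrable setT (EFin \o u) -> m2.-integrable setT (EFin \o v) ->
  m3.-integrable setT (EFin \o w) -> measurable_fun setT F ->
  (forall z, `|F z| <= k * (u z.1 * (v z.2.1 * w z.2.2))) ->
  (m1 \x (m2 \x m3))%E.-integrable setT (fun z => (F z)%:E).
Proof.
move=> iu iv iw mF Fle.
have ivw := integrable_prodM iv iw.
pose m23 : {sigma_finite_measure set (T2 * T3)%type -> \bar R} :=
  HB.pack (m2 \x m3)%E (Measure_isSigmaFinite.Build _ _ _ _ (sigma_finite_prod m2 m3)).
have iuvw := @integrable_prodM _ _ _ _ _ m1 m23 u (fun z => v z.1 * w z.2) iu ivw.
have ik := integrableZl measurableT k iuvw.
apply: (le_integrable measurableT _ _ ik) => /=; first exact/measurable_EFinP.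
move=> z _; rewrite lee_fin (le_trans (Fle z))// ler_norm//.
Qed.

(** * Integrals over rectangles and segments *)

Section RectangleIntegral.
Context {R : realType}.
Notation leb := (@lebesgue_measure R).

Lemma Rintegral_rectangleM (a b c d : R) (phi psi : R -> R) :
  continuous phi -> continuous psi ->
  \int[(leb \x leb)%E]_(z in `[a, b] `*` `[c, d]) (phi z.1 * psi z.2) =
  (\int[leb]_(x in `[a, b]) phi x) * (\int[leb]_(y in `[c, d]) psi y).
Proof.
have int (g : R -> R) (e f : R) : continuous g ->
    leb.-integrable setT (EFin \o (g \_ `[e, f])).
  move=> cg; rewrite -restrict_EFin; apply/integrable_restrict => //.
  rewrite setTI; apply: continuous_compact_integrable; first exact: segment_compact.
  exact: continuous_subspaceT.
move=> cphi cpsi.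
have iphi := int phi a b cphi; have ipsi := int psi c d cpsi.
(* The product formula concerns whole spaces, so the restrictions to the segments move into the
   integrands, where the indicator of the rectangle factors. *)
rewrite Rintegral_mkcond [X in _ = X * _]Rintegral_mkcond [X in _ = _ * X]Rintegral_mkcond.
rewrite /Rintegral -fineM; last 2 first.
- exact: integrable_fin_num.
- exact: integrable_fin_num.
rewrite -integral_prodM//; congr fine; apply: eq_integral => -[x y] _ /=.
congr EFin; rewrite !patchE /= in_setX.
by case: (x \in _); case: (y \in _); rewrite /= ?mulr0 ?mul0r.
Qed.

Lemma Rintegral_segment (F f : R -> R) (a b : R) : a < b -> continuous f ->
  (forall x, is_derive x (1 : R) F (f x)) -> \int[leb]_(x in `[a, b]) f x = F b - F a.
Proof.
move=> ab cf dF.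
have cF x : {for x, continuous F}.
  by apply: differentiable_continuous; apply/derivable1_diffP; have [] := dF x.
rewrite /Rintegral (continuous_FTC2 (F := F) ab)//.
- exact: continuous_subspaceT.
- split.
  + by move=> x _; have [] := dF x.
  + by apply: cvg_at_right_filter; exact: cF.
  + by apply: cvg_at_left_filter; exact: cF.
- by move=> x _; rewrite derive1E derive_val.
Qed.

End RectangleIntegral.

(** * Integrability on R^3 of symbols of order 4 *)

Section DecayIntegrable.
Context {R : realType}.
Notation leb := (@lebesgue_measure R).

(** Each of the three coordinates takes a third of the decay r^-4; the exponent 4/3 exceeds 1, so
    [h] is integrable on the line. *)
Let h (t : R) : R := (1 + `|t|) `^ (- (4 / 3)).

Let h_ge0 t : 0 <= h t. Proof. exact: powR_ge0. Qed.

Let h_continuous : continuous h.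
Proof.
move=> t; rewrite /h.
have c1 : {for t, continuous (fun t : R => 1 + `|t|)}.
  by apply: cvgD; [exact: cvg_cst|exact: norm_continuous].
apply: (@continuous_comp _ _ _ (fun t : R => 1 + `|t|) (fun z => z `^ (- (4 / 3)))) => //.
apply: differentiable_continuous; apply/derivable1_diffP.
have t0 : 0 < 1 + `|t| by rewrite ltr_pwDl.
by have [] := is_derive1_powR (- (4 / 3)) t0.
Qed.

(** [h] is even, and on the half-line it has the primitive - 3 (1 + t)^(-1/3), which tends to 0 at
    infinity. *)
Let h_integrable : leb.-integrable setT (EFin \o h).
Proof.
apply/integrableP; split.
  by apply/measurable_EFinP; apply: continuous_measurable_fun; exact: h_continuous.
have -> : (\int[leb]_x `|(EFin \o h) x| = \int[leb]_x (h x)%:E)%E.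
  by apply: eq_integral => x _ /=; rewrite ger0_norm.
rewrite ge0_symfun_integralT//; last by move=> x; rewrite /h /= normrN.
have -> : [set x : R | (0 <= x)%R] = `[0, +oo[%classic.
  by apply/seteqP; split => x; rewrite /= in_itv/= andbT.
pose H (t : R) := (1 + t) `^ (- (4 / 3)).
pose F (t : R) := - 3 * (1 + t) `^ (- (1 / 3)).
have dF (t : R) : 0 <= t -> is_derive t (1 : R) F (H t).
  move=> t0; have t1 : 0 < 1 + t by rewrite ltr_pwDl.
  have dp := is_derive1_powR (- (1 / 3)) t1.
  have ds : is_derive t (1 : R) (fun t : R => 1 + t) 1.
    rewrite (_ : (fun t : R => 1 + t) = shift 1); first exact: is_derive_shift.
    by apply/funext => z; rewrite /= addrC.
  have dc := is_derive1_comp dp ds.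
  have dm := is_deriveZ (- 3 : R) dc.
  apply: is_derive_eq dm _; rewrite /H /GRing.scale/=.
  rewrite (_ : - (1 / 3) - 1 = - (4 / 3) :> R); last by field.
  by field.
have cF (t : R) : 0 <= t -> {for t, continuous F}.
  move=> t0; apply: differentiable_continuous; apply/derivable1_diffP.
  by have [] := dF t t0.
have F0 : F x @[x --> +oo] --> (0 : R).
  rewrite -(mulr0 (- 3)); apply: cvgM; first exact: cvg_cst.
  apply/cvgr0Pnorm_le => e e0; near=> x.
  have x0 : 0 <= x by near: x; apply: nbhs_pinfty_ge; exact: num_real.
  have xe : (e^-1) `^ 3 <= x by near: x; apply: nbhs_pinfty_ge; exact: num_real.
  rewrite ger0_norm ?powR_ge0// powRN -[e]invrK lef_pV2 ?posrE ?invr_gt0//; last first.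
    by rewrite powR_gt0// ltr_pwDl.
  have -> : e^-1 = (e^-1 `^ 3) `^ (1 / 3).
    by rewrite -powRrM (_ : 3 * (1 / 3) = 1 :> R) ?powRr1 ?invr_ge0 ?ltW//; field.
  rewrite ge0_ler_powR ?nnegrE ?powR_ge0 ?addr_ge0//; lra.
have cH (t : R) : 0 <= t -> {for t, continuous H}.
  move=> t0; have t1 : 0 < 1 + t by rewrite ltr_pwDl.
  apply: (@continuous_comp _ _ _ (fun t : R => 1 + t) (fun z => z `^ (- (4 / 3)))).
    by apply: cvgD; [exact: cvg_cst|exact: cvg_id].
  apply: differentiable_continuous; apply/derivable1_diffP.
  by have [] := is_derive1_powR (- (4 / 3)) t1.
rewrite (_ : (\int[leb]_(x in `[0%R, +oo[) (h x)%:E = \int[leb]_(x in `[0%R, +oo[) (H x)%:E)%E).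
  rewrite (ge0_continuous_FTC2y (F := F) (l := 0))//.
  - by rewrite -EFinB -EFinM ltry.
  - by move=> x _; exact: powR_ge0.
  - apply/continuous_within_itvcyP; split.
      by move=> x x0; apply: cH; move: x0; rewrite ?in_itv/= ?andbT; exact: ltW.
    by apply: cvg_at_right_filter; exact: cH.
  - by move=> x x0; have [] := dF x (ltW x0).
  - by apply: cvg_at_right_filter; exact: cF.
  - by move=> x; rewrite in_itv/= andbT => x0; have dFx := dF x (ltW x0); rewrite derive1E derive_val.
by apply: eq_integral => x; rewrite inE/= in_itv/= andbT => x0; rewrite /h ger0_norm.
Unshelve. all: by end_near.
Qed.

(** Both 1 and each |x_i| are at most the weight w, hence (1 + |x_i|) / 2 <= w; the 4/3 powers of
    these three inequalities multiply to the claim, with the constant 16 in the guise of a power of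
    1/2. *)
Let decay4_le : exists K : R, forall x y z : R,
  decay (vec3 x y z) ^+ 4 <= K * (h x * (h y * h z)).
Proof.
exists ((2^-1 `^ (4 / 3)) ^+ 3)^-1 => x y z.
set w := weight (vec3 x y z).
have w0 : 0 < w by exact: weight_gt0.
have kw (t : R) : `|t| <= enorm (vec3 x y z) -> (2^-1 `^ (4 / 3)) * (h t)^-1 <= w `^ (4 / 3).
  move=> tw.
  rewrite /h powRN invrK -powRM ?invr_ge0 ?addr_ge0//.
  rewrite ge0_ler_powR// ?nnegrE; last 3 first.
  - by rewrite mulr_ge0// addr_ge0.
  - exact: ltW.
  have ew : enorm (vec3 x y z) <= w.
    by rewrite -[leLHS]ger0_norm ?sqrtr_ge0// -sqrtr_sqr ler_wsqrtr// lerDr.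
  by rewrite ler_pdivrMl// mulr2n mulrDl mul1r lerD ?weight_ge1// (le_trans tw).
have hx : `|x| <= enorm (vec3 x y z) by have := enorm_ge_coord (vec3 x y z) 0; rewrite mxE.
have hy : `|y| <= enorm (vec3 x y z) by have := enorm_ge_coord (vec3 x y z) 1; rewrite mxE.
have hz : `|z| <= enorm (vec3 x y z) by have := enorm_ge_coord (vec3 x y z) 2; rewrite mxE.
have h0 (t : R) : 0 < h t by rewrite powR_gt0// ltr_pwDl.
have k0 : 0 < 2^-1 `^ (4 / 3) :> R by rewrite powR_gt0.
have w4 : w ^+ 4 = (w `^ (4 / 3)) ^+ 3.
  rewrite -[RHS]powR_mulrn ?powR_ge0// -powRrM -powR_mulrn ?ltW//.
  by congr (_ `^ _); field.
rewrite /decay -/w exprVn w4.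
rewrite (_ : (_ ^+ 3)^-1 * _ = ((2^-1 `^ (4 / 3) * (h x)^-1) * ((2^-1 `^ (4 / 3) * (h y)^-1)
   * (2^-1 `^ (4 / 3) * (h z)^-1)))^-1); last first.
  by move: (h0 x) (h0 y) (h0 z) k0 => /lt0r_neq0 + /lt0r_neq0 + /lt0r_neq0 + /lt0r_neq0;
     move: (h x) (h y) (h z) (2^-1 `^ _) => ? ? ? ? ? ? ? ?; field; do !(apply/andP; split).
have hi (t : R) : 0 < 2^-1 `^ (4 / 3) * (h t)^-1 by rewrite mulr_gt0 ?invr_gt0.
rewrite lef_pV2 ?posrE ?mulr_gt0 ?exprn_gt0 ?powR_gt0//.
rewrite !exprS expr0 mulr1.
have hi0 t := ltW (hi t).
apply: ler_pM => //; [exact: mulr_ge0|exact: kw|].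
by apply: ler_pM => //; exact: kw.
all: by rewrite invr_gt0.
Qed.

(** The density sqrt(det g) is bounded, the determinant being a polynomial in entries of order 0, so
    the decay of [u] decides. *)
Lemma symbol_integrable_vol (g : 'rV[R]_3 -> 'M[R]_3) (u : 'rV[R]_3 -> R) :
  symbol 4 u -> (forall i j, symbol 0 (fun x => g x i j)) -> integrable_vol g u.
Proof.
move=> su sg.
have sdet : symbol 0 (fun x => \det (g x)).
  apply: symbol_sum => sg'; apply: symbolMl; exact: symbol_prod.
have [C C0 uC] := symbol_bound su; have [D D0 gD] := symbol_bound sdet.
have [K HK] := decay4_le.
apply: (integrable_le_prodM3 (k := C * Num.sqrt D * K) h_integrable h_integrable h_integrable).
  apply: measurable_funM; first exact: symbol_measurable su.
  apply: measurableT_comp; last exact: symbol_measurable sdet.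
  by apply: continuous_measurable_fun; exact: sqrt_continuous.
move=> [x [y z]] /=; set q := vec3 _ _ _.
apply: (@le_trans _ _ (C * Num.sqrt D * decay q ^+ 4)); last first.
  by rewrite -[leRHS]mulrA ler_wpM2l ?HK// mulr_ge0// sqrtr_ge0.
rewrite normrM mulrAC ler_pM// ger0_norm ?sqrtr_ge0// ler_wsqrtr//.
by rewrite (le_trans (ler_norm _))// (le_trans (gD q))// expr0 mulr1.
Qed.

End DecayIntegrable.

(** * Scalar curvature *)

Section ScalarCurvature.
Context {R : realType}.
Variables (lam t0 eps : R).
Hypothesis lam_gt0 : 0 < lam.
Implicit Types (x : 'rV[R]_3) (i j k l m : 'I_3).

Notation st := (deSitter lam).
Notation f := (perturbed_time t0 eps).
Notation P := (expR (t0 / lam)).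
Notation c := (2 * eps / lam).
Notation s := (@decay R).
Notation p := dirn.
Notation g := (induced_metric st f).

Hypothesis slope_le : forall x, slope lam f x <= 2^-1.

Let P0 : P != 0. Proof. exact: lt0r_neq0 (expR_gt0 _). Qed.

Lemma symbol_metric i j : symbol 0 (fun x => g x i j).
Proof.
rewrite (_ : (fun x => _) = fun x => P ^+ 2 * expdecay c x * (i == j)%:R
    - eps ^+ 2 * (s x ^+ 4 * p i x * p j x)); last first.
  by apply/funext => x; rewrite induced_metric_perturbed//; ring.
apply: symbolB.
  apply: (symbolM (m1 := 0) (m2 := 0)); last exact: symbol_cst.
  by apply: symbolMl; exact: symbol_expdecay.
by apply: symbolMl; apply: (@symbol_le _ 4) => //; exact: symbol_decay_dirn2.
Qed.

(** The metric to first order in s, which is the conformally flat P^2 (1 + c s) delta; the term df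
    df has order 4 and does not show. *)
Let g1 i j x : R := P ^+ 2 * (i == j)%:R + (P ^+ 2 * c * (i == j)%:R) * s x.

Lemma symbol_metric_linear i j : symbol 2 (fun x => g x i j - g1 i j x).
Proof.
rewrite (_ : (fun x => _) = fun x => P ^+ 2 * (i == j)%:R * (expdecay c x - 1 - c * s x)
    - eps ^+ 2 * (s x ^+ 4 * p i x * p j x)); last first.
  by apply/funext => x; rewrite induced_metric_perturbed// /g1; ring.
apply: symbolB; first by apply: symbolMl; exact: symbol_expdecayB1B.
by apply: symbolMl; apply: (@symbol_le _ 4) => //; exact: symbol_decay_dirn2.
Qed.

(** Order 1 suffices, because this difference gets multiplied by metric derivatives, of order 2, and
    by the Ricci tensor, of order 3. *)
Lemma symbol_inverse_metric i j :
  symbol 1 (fun x => invmx (g x) i j - P ^- 2 * (i == j)%:R).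
Proof.
have [sV _] := symbol_tilt lam_gt0 slope_le.
rewrite (_ : (fun x => _) = fun x => P ^- 2 * (i == j)%:R * (expdecay (- c) x - 1)
    + (P ^- 2) ^+ 2 * eps ^+ 2 * (tilt lam f x ^+ 2 * expdecay (- c) x ^+ 2
       * (s x ^+ 4 * p i x * p j x))); last first.
  by apply/funext => x; rewrite invmx_induced_metric_perturbed//; ring.
apply: symbolD; first by apply: symbolMl; exact: symbol_expdecayB1.
apply: symbolMl; apply: (symbolM (m1 := 0)).
  apply: (symbolM (m1 := 0) (m2 := 0)); first exact: (symbolX 2 sV).
  exact: (symbolX 2 (symbol_expdecay _)).
by apply: (@symbol_le _ 4) => //; exact: symbol_decay_dirn2.
Qed.

Let partial_g1 k i j :
  partial k (g1 i j) = fun x => P ^+ 2 * c * (i == j)%:R * partial k s x.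
Proof.
apply/funext => x; rewrite /g1.
have dd := @differentiable_decay R x.
have dc : differentiable (fun=> P ^+ 2 * (i == j)%:R) x by exact: differentiable_cst.
have dm : differentiable (fun y => P ^+ 2 * c * (i == j)%:R * s y) x.
  by apply: differentiableM => //; exact: differentiable_cst.
by rewrite (partialD k dc dm) partial_cst add0r partialMl.
Qed.

Lemma symbol_partial_metric_linear k i j : symbol 3
  (fun x => partial k (fun y => g y i j) x - P ^+ 2 * c * (i == j)%:R * partial k s x).
Proof.
have := symbol_partialB k (symbol_metric_linear i j)
  (fun x => symbol_differentiable x (symbol_metric i j)).
rewrite partial_g1; apply => x.
apply: differentiableD; first exact: differentiable_cst.
apply: differentiableM; [exact: differentiable_cst|exact: differentiable_decay].
Qed.

Let symbol_partial_decay k : symbol 2 (partial k s).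
Proof. exact: symbol_partial symbol_decay. Qed.

(** Reads the order of [u] off its leading term [v] once the remainder is known to be smaller. *)
Let symbol_split n n' (u v : 'rV[R]_3 -> R) : (n <= n')%N ->
  symbol n' (fun x => u x - v x) -> symbol n v -> symbol n u.
Proof.
move=> nn' suv sv; rewrite (_ : u = fun x => (u x - v x) + v x).
  by apply: symbolD => //; exact: symbol_le suv.
by apply/funext => x; rewrite subrK.
Qed.

Lemma symbol_partial_metric k i j : symbol 2 (partial k (fun y => g y i j)).
Proof.
apply: (symbol_split (n' := 3) _ (symbol_partial_metric_linear k i j)) => //.
by apply: symbolMl; exact: symbol_partial_decay.
Qed.

(* Christoffel symbols of P^2 (1 + c s) delta to first order in s. *)
Let G1 k i j x : R := c / 2 *
  ((j == k)%:R * partial i s x + (i == k)%:R * partial j s x - (i == j)%:R * partial k s x).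

Let symbol_G1 k i j : symbol 2 (G1 k i j).
Proof.
apply: symbolMl; apply: symbolB; first apply: symbolD.
all: by apply: symbolMl; exact: symbol_partial_decay.
Qed.

(** Splitting the inverse metric into its limit P^-2 delta and a remainder leaves a quadratic term
    of order 1 + 2 and the linearisation errors of the metric derivatives, of order 3. *)
Lemma symbol_christoffel_linear k i j :
  symbol 3 (fun x => christoffel g k i j x - G1 k i j x).
Proof.
pose B l x := partial i (fun y => g y j l) x + partial j (fun y => g y i l) x
  - partial l (fun y => g y i j) x.
pose D k i j x := partial k (fun y => g y i j) x - P ^+ 2 * c * (i == j)%:R * partial k s x.
rewrite (_ : (fun x => _) = fun x =>
    2^-1 * (\sum_l (invmx (g x) k l - P ^- 2 * (k == l)%:R) * B l x)
    + 2^-1 * (P ^- 2 * (D i j k x + D j i k x - D k i j x))).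
  apply: symbolD; apply: symbolMl.
    apply: symbol_sum => l; apply: (symbolM (m1 := 1) (m2 := 2)).
      exact: symbol_inverse_metric.
    by apply: symbolB; [apply: symbolD|]; exact: symbol_partial_metric.
  by apply: symbolMl; apply: symbolB; [apply: symbolD|]; exact: symbol_partial_metric_linear.
apply/funext => x; rewrite /christoffel.
under [in RHS]eq_bigr do rewrite mulrBl -mulrA.
rewrite sumrB -mulr_sumr sum_delta /D /G1 /B.
set S := \sum_l _.
move: S (partial i (fun y => g y j k) x) (partial j (fun y => g y i k) x)
  (partial k (fun y => g y i j) x) (partial i s x) (partial j s x) (partial k s x).
move: P0; move: P (i == j) (i == k) (j == k) => Q b1 b2 b3 Q0 S a1 a2 a3 d1 d2 d3.
by field; rewrite Q0 lt0r_neq0.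
Qed.

Lemma symbol_christoffel k i j : symbol 2 (christoffel g k i j).
Proof. exact: (symbol_split _ (symbol_christoffel_linear k i j) (symbol_G1 k i j)). Qed.

Let partial_G1 m k i j : partial m (G1 k i j) = fun x => c / 2 *
  ((j == k)%:R * partial m (partial i s) x + (i == k)%:R * partial m (partial j s) x
   - (i == j)%:R * partial m (partial k s) x).
Proof.
apply/funext => x.
have dp l : differentiable (partial l s) x by exact: symbol_differentiable (symbol_partial_decay l).
have dM (b : R) l : differentiable (fun y => b * partial l s y) x.
  by apply: differentiableM => //; exact: differentiable_cst.
have dD : differentiable (fun y => (j == k)%:R * partial i s y + (i == k)%:R * partial j s y) x.
  exact: differentiableD.
have d3 : differentiable (fun y => (j == k)%:R * partial i s y + (i == k)%:R * partial j s y
    + - (i == j)%:R * partial k s y) x.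
  exact: differentiableD.
rewrite (_ : G1 k i j = fun y => c / 2 * ((j == k)%:R * partial i s y +
    (i == k)%:R * partial j s y + - (i == j)%:R * partial k s y)); last first.
  by apply/funext => y; rewrite /G1 mulNr.
rewrite (partialMl _ _ d3) (partialD m dD (dM _ _)) (partialD m (dM _ _) (dM _ _)).
rewrite -mulNr; congr (_ * (_ + _ + _)); exact: partialMl.
Qed.

Lemma symbol_partial_christoffel_linear m k i j : symbol 4
  (fun x => partial m (christoffel g k i j) x - partial m (G1 k i j) x).
Proof.
apply: symbol_partialB; first exact: symbol_christoffel_linear.
  by move=> x; exact: symbol_differentiable (symbol_christoffel k i j).
by move=> x; exact: symbol_differentiable (symbol_G1 k i j).
Qed.

(** The linearised Ricci tensor: products of two Christoffel symbols have order 2 + 2 and are left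
    to the remainder. *)
Let R1 i j x : R := \sum_k (partial k (G1 k i j) x - partial j (G1 k i k) x).

Lemma symbol_ricci_linear i j : symbol 4 (fun x => ricci g x i j - R1 i j x).
Proof.
rewrite (_ : (fun x => _) = fun x => \sum_k
   ((partial k (christoffel g k i j) x - partial k (G1 k i j) x)
    - (partial j (christoffel g k i k) x - partial j (G1 k i k) x)
    + \sum_l (christoffel g k k l x * christoffel g l i j x
                    - christoffel g k j l x * christoffel g l i k x))).
  apply: symbol_sum => k; apply: symbolD.
    by apply: symbolB; exact: symbol_partial_christoffel_linear.
  apply: symbol_sum => l.
  by apply: symbolB; apply: (symbolM (m1 := 2) (m2 := 2)); exact: symbol_christoffel.
apply/funext => x; rewrite mxE /R1 -sumrB; apply: eq_bigr => k _.
move: (\sum_l _) (partial k (christoffel g k i j) x) (partial k (G1 k i j) x).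
by move: (partial j (christoffel g k i k) x) (partial j (G1 k i k) x) => *; ring.
Qed.

Let symbol_R1 i j : symbol 3 (R1 i j).
Proof.
apply: symbol_sum => k; apply: symbolB; exact: symbol_partial (symbol_G1 _ _ _).
Qed.

Lemma symbol_ricci i j : symbol 3 (fun x => ricci g x i j).
Proof. exact: (symbol_split _ (symbol_ricci_linear i j) (symbol_R1 i j)). Qed.

(** With [h] the Hessian of s this is the linearised conformal formula: (1 + b s) delta has scalar
    curvature - (n - 1) b Lap s, here with n = 3. *)
Let ricci_trace_identity (b : R) (h : 'I_3 -> 'I_3 -> R) :
  \sum_i \sum_k (b / 2 * ((i == k)%:R * h k i + (i == k)%:R * h k i - (i == i)%:R * h k k)
     - b / 2 * ((k == k)%:R * h i i + (i == k)%:R * h i k - (i == k)%:R * h i k)) =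
  - 2 * b * \sum_k h k k.
Proof.
rewrite !big_ord_recl !big_ord0 /= ?(mulr1n, mulr0n).
move: (h _ _) (h _ _) (h _ _) (h _ _) (h _ _) (h _ _) (h _ _) (h _ _) (h _ _) => *.
by field.
Qed.

(* To first order the scalar curvature is a multiple of the Laplacian of s, which is O(s^5)
   because 1/r is harmonic. *)
Let R1_trace x : \sum_i R1 i i x = 6 * c * s x ^+ 5.
Proof.
have H : \sum_k partial k (partial k s) x = - 3 * s x ^+ 5.
  under eq_bigr do rewrite partial2_decay eqxx mulrBr mulr1 -mulrA -expr2 mulrCA.
  rewrite sumrB -mulr_sumr -mulr_sumr dirn_sqr_sum sumr_const card_ord.
  by rewrite -mulr_natl; ring.
have -> : 6 * c * s x ^+ 5 = - 2 * c * \sum_k partial k (partial k s) x.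
  by rewrite H; ring.
rewrite -(ricci_trace_identity c (fun i j => partial i (partial j s) x)).
by apply: eq_bigr => i _; apply: eq_bigr => k _; rewrite !partial_G1.
Qed.

(** The Ricci tensor only has order 3, borderline for integrability. Replacing the inverse metric by
    its limit costs order 1 + 3, linearising Ricci costs order 4, and the surviving trace is the
    explicit multiple of s^5. *)
Lemma symbol_scalar_curv : symbol 4 (scalar_curv g).
Proof.
rewrite (_ : scalar_curv g = fun x =>
    \sum_i \sum_j ((invmx (g x) i j - P ^- 2 * (i == j)%:R) * ricci g x j i)
    + P ^- 2 * (\sum_i (ricci g x i i - R1 i i x)) + P ^- 2 * (6 * c) * s x ^+ 5).
  apply: symbolD; first apply: symbolD.
  - apply: symbol_sum => i; apply: symbol_sum => j.
    by apply: (symbolM (m1 := 1) (m2 := 3)); [exact: symbol_inverse_metric|exact: symbol_ricci].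
  - by apply: symbolMl; apply: symbol_sum => i; exact: symbol_ricci_linear.
  - by apply: symbolMl; apply: (@symbol_le _ 5) => //; exact: symbol_decayX.
apply/funext => x; rewrite /scalar_curv /mtrace /mxtrace.
rewrite sumrB R1_trace.
have -> : \sum_i \sum_j ((invmx (g x) i j - P ^- 2 * (i == j)%:R) * ricci g x j i) =
    \sum_i \sum_j invmx (g x) i j * ricci g x j i - P ^- 2 * \sum_i ricci g x i i.
  rewrite mulr_sumr -sumrB; apply: eq_bigr => i _.
  under eq_bigr do rewrite mulrBl -mulrA.
  by rewrite sumrB -mulr_sumr sum_delta.
under eq_bigr do rewrite mxE.
rewrite [LHS](_ : _ = \sum_i \sum_j invmx (g x) i j * ricci g x j i)//.
have E (a b d e r : R) : a = a - d * b + d * (b - e * r) + d * e * r by ring.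
exact: E.
Qed.

End ScalarCurvature.

(** * Integrals over coordinate spheres *)

Section SphereIntegrals.
Context {R : realType}.
Implicit Types (u : 'rV[R]_3 -> R).

Notation polar r a := (vec3 (r * sin a.1 * cos a.2) (r * sin a.1 * sin a.2) (r * cos a.1)).

Lemma polar_sqnorm (r : R) (a : R * R) : \sum_i polar r a 0 i ^+ 2 = r ^+ 2.
Proof.
rewrite !big_ord_recl big_ord0 !mxE /=.
have h1 := cos2Dsin2 a.1; have h2 := cos2Dsin2 a.2.
rewrite !exprMn addr0 addrA -mulrDr h2 mulr1 -mulrDr addrC.
by rewrite h1 mulr1.
Qed.

Lemma sphere_integral_cst (r C : R) u : (forall x : 'rV[R]_3, \sum_i x 0 i ^+ 2 = r ^+ 2 -> u x = C) ->
  sphere_integral r u = 4 * pi * r ^+ 2 * C.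
Proof.
move=> uC; rewrite /sphere_integral.
under eq_Rintegral do rewrite uC ?polar_sqnorm//.
pose phi (t : R) := C * (r ^+ 2 * sin t).
transitivity (\int[(lebesgue_measure \x lebesgue_measure)%E]_(z in
    `[0, pi] `*` `[0, 2 * pi]) (phi z.1 * cst (1 : R) z.2)).
  by apply: eq_Rintegral => z _; rewrite mulr1.
have cphi : continuous phi.
  move=> t; apply: cvgM; first exact: cvg_cst.
  by apply: cvgM; [exact: cvg_cst|exact: continuous_sin].
rewrite Rintegral_rectangleM//; last by move=> t; exact: cvg_cst.
have dphi (t : R) : is_derive t (1 : R) (fun t => - (C * r ^+ 2) * cos t) (phi t).
  apply: is_derive_eq (is_deriveZ (- (C * r ^+ 2)) (is_derive_cos t)) _.
  by rewrite /phi /GRing.scale/=; ring.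
rewrite (Rintegral_segment (pi_gt0 R) cphi dphi).
rewrite (@Rintegral_segment _ id)//; last 2 first.
- by rewrite mulr_gt0// pi_gt0.
- by move=> t; exact: cvg_cst.
by rewrite cospi cos0; ring.
Qed.

(** In polar coordinates the integrand separates. For the first two coordinates the azimuthal
    factor, cos or sin over a full period, integrates to 0; for the third it is cos sin over the
    polar angle in [0, pi]. *)
Lemma sphere_integral_coord (r C : R) k u :
  (forall x : 'rV[R]_3, \sum_i x 0 i ^+ 2 = r ^+ 2 -> u x = C * x 0 k) ->
  sphere_integral r u = 0.
Proof.
move=> uC; rewrite /sphere_integral.
under eq_Rintegral do rewrite uC ?polar_sqnorm//.
have pi2 : 0 < 2 * pi :> R by rewrite mulr_gt0// pi_gt0.
have csin2 : continuous (fun t : R => C * (r ^+ 3 * sin t ^+ 2)).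
  move=> t; apply: cvgM; first exact: cvg_cst.
  apply: cvgM; first exact: cvg_cst.
  by apply: (@cvgM _ _ _ _ sin sin); exact: continuous_sin.
have rect (phi psi : R -> R) : continuous phi -> continuous psi ->
    (forall a : R * R, C * polar r a 0 k * (r ^+ 2 * sin a.1) = phi a.1 * psi a.2) ->
    (\int[lebesgue_measure]_(t in `[0, pi]) phi t = 0 \/
     \int[lebesgue_measure]_(t in `[0, 2 * pi]) psi t = 0) ->
    \int[(lebesgue_measure \x lebesgue_measure)%E]_(z in `[0, pi] `*` `[0, 2 * pi])
      (C * polar r z 0 k * (r ^+ 2 * sin z.1)) = 0.
  move=> cphi cpsi E I0.
  transitivity (\int[(lebesgue_measure \x lebesgue_measure)%E]_(z in
    `[0, pi] `*` `[0, 2 * pi]) (phi z.1 * psi z.2)).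
    by apply: eq_Rintegral => z _; exact: E.
  rewrite Rintegral_rectangleM//.
  by case: I0 => ->; rewrite ?mul0r ?mulr0.
case: k uC rect => [[|[|[|//]]] ltk] uC rect.
- apply: (rect (fun t => C * (r ^+ 3 * sin t ^+ 2)) cos) => //.
  + exact: continuous_cos.
  + by move=> a; rewrite mxE /=; ring.
  + right; rewrite (@Rintegral_segment _ sin)//; last exact: continuous_cos.
    by rewrite sin0 mulr_natl sin2pi subr0.
- apply: (rect (fun t => C * (r ^+ 3 * sin t ^+ 2)) sin) => //.
  + exact: continuous_sin.
  + by move=> a; rewrite mxE /=; ring.
  + have dsin (t : R) : is_derive t (1 : R) (fun t => -1 * cos t) (sin t).
      apply: is_derive_eq (is_deriveZ (-1) (is_derive_cos t)) _.
      by rewrite /GRing.scale/=; ring.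
    right; rewrite (Rintegral_segment pi2 (@continuous_sin R) dsin).
    by rewrite cos0 mulr_natl cos2pi subrr.
- apply: (rect (fun t => (C * r ^+ 3) * (cos t * sin t)) (cst 1)) => //.
  + move=> t; apply: cvgM; first exact: cvg_cst.
    by apply: cvgM; [exact: continuous_cos|exact: continuous_sin].
  + by move=> t; exact: cvg_cst.
  + by move=> a; rewrite mxE /=; ring.
  + have ccs : continuous (fun t : R => (C * r ^+ 3) * (cos t * sin t)).
      move=> t; apply: cvgM; first exact: cvg_cst.
      by apply: cvgM; [exact: continuous_cos|exact: continuous_sin].
    have dcs (t : R) : is_derive t (1 : R) (fun t => (C * r ^+ 3 / 2) * (sin t * sin t))
        ((C * r ^+ 3) * (cos t * sin t)).
      have ds : is_derive t (1 : R) (fun t => sin t * sin t) (2 * (cos t * sin t)).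
        apply: is_derive_eq (is_deriveM (is_derive_sin t) (is_derive_sin t)) _.
        by rewrite /GRing.scale/=; ring.
      apply: is_derive_eq (is_deriveZ (C * r ^+ 3 / 2) ds) _.
      by rewrite /GRing.scale/=; field.
    left; rewrite (Rintegral_segment (pi_gt0 R) ccs dcs).
    by rewrite sinpi sin0; ring.
Qed.

End SphereIntegrals.

(** * Energy, momentum and mean curvature *)

Section PerturbedSliceCharges.
Context {R : realType}.
Variables (lam Lam t0 eps : R).
Hypotheses (lam_gt0 : 0 < lam) (LamE : Lam = 3 / lam ^+ 2).
Implicit Types (x y : 'rV[R]_3) (i j k : 'I_3).

Notation st := (deSitter lam).
Notation f := (perturbed_time t0 eps).
Notation P := (expR (t0 / lam)).
Notation c := (2 * eps / lam).
Notation s := (@decay R).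
Notation p := dirn.
Notation g := (induced_metric st f).
Notation K := (second_ff st f).

Hypothesis slope_le : forall x, slope lam f x <= 2^-1.

Let P_gt0 : 0 < P. Proof. exact: expR_gt0. Qed.
Let P0 : P != 0. Proof. exact: lt0r_neq0. Qed.
Let lam0 : lam != 0. Proof. exact: lt0r_neq0. Qed.

Lemma sqrt_Lam3 : Num.sqrt (Lam / 3) = lam^-1.
Proof.
have -> : Lam / 3 = lam^-1 ^+ 2 by rewrite LamE; field.
by rewrite sqrtr_sqr ger0_norm// invr_ge0 ltW.
Qed.

(** [hdiag] and [hrank1] are the coefficients of delta_ij and p_i p_j in the rescaled h; both depend
    on x through s alone. *)
Let hdiag x : R := P^-1 * (tilt lam f x * (- (eps * s x ^+ 3) + P ^+ 2 * expdecay c x / lam)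
  - P ^+ 2 * expdecay c x / lam).
Let hrank1 x : R := P^-1 * (tilt lam f x * (3 * eps * s x ^+ 3 - 2 / lam * eps ^+ 2 * s x ^+ 4)
  + eps ^+ 2 * s x ^+ 4 / lam).

Lemma rescaled_metric_perturbed x i j : rescaled_metric P g x i j =
  expdecay c x * (i == j)%:R - P ^- 2 * eps ^+ 2 * (s x ^+ 4 * p i x * p j x).
Proof. by rewrite mxE induced_metric_perturbed//; field. Qed.

Lemma rescaled_h_perturbed x i j : rescaled_h Lam P g K x i j =
  hdiag x * (i == j)%:R + hrank1 x * (p i x * p j x).
Proof.
transitivity (P^-1 * (K x i j - lam^-1 * g x i j)).
  by rewrite /rescaled_h sqrt_Lam3 !mxE.
rewrite second_ff_perturbed// induced_metric_perturbed//.
by rewrite /hdiag /hrank1; ring.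
Qed.

Lemma symbol_rescaled_metric i j :
  symbol 1 (fun x => (rescaled_metric P g x - 1%:M) i j).
Proof.
rewrite (_ : (fun x => _) = fun x => (i == j)%:R * (expdecay c x - 1)
    - P ^- 2 * eps ^+ 2 * (s x ^+ 4 * p i x * p j x)); last first.
  apply/funext => x; rewrite mxE rescaled_metric_perturbed !mxE.
  by move: (expdecay c x) (s x ^+ 4 * p i x * p j x) => *; case: (i == j); rewrite ?mulr1n ?mulr0n; ring.
apply: symbolB; apply: symbolMl; first exact: symbol_expdecayB1.
by apply: (@symbol_le _ 4) => //; exact: symbol_decay_dirn2.
Qed.

(** The terms of order 0 in K and g / lam cancel up to the factor V - 1, of order 4. The Hessian
    term of order 3 then dominates, which is more than the order tau + 1 = 2 required. *)
Lemma symbol_rescaled_h i j : symbol 2 (fun x => rescaled_h Lam P g K x i j).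
Proof.
have [sV sV1] := symbol_tilt lam_gt0 slope_le.
rewrite (_ : (fun x => _) = fun x =>
   P^-1 * ((tilt lam f x - 1) * (P ^+ 2 / lam * (i == j)%:R * expdecay c x))
   + (P^-1 * - eps * (i == j)%:R) * (tilt lam f x * s x ^+ 3)
   + P^-1 * 3 * eps * (tilt lam f x * (s x ^+ 3 * p i x * p j x))
   + P^-1 * eps ^+ 2 / lam * ((-2 * tilt lam f x + 1) * (s x ^+ 4 * p i x * p j x)));
   last first.
  by apply/funext => x; rewrite rescaled_h_perturbed /hdiag /hrank1; ring.
apply: symbolD; first apply: symbolD; first apply: symbolD.
- apply: symbolMl; apply: (@symbol_le _ 4) => //.
  apply: (symbolM (m1 := 4) (m2 := 0)) => //.
  by apply: symbolMl; exact: symbol_expdecay.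
- apply: symbolMl; apply: (@symbol_le _ 3) => //.
  by apply: (symbolM (m1 := 0)) => //; exact: symbol_decayX.
- apply: symbolMl; apply: (@symbol_le _ 3) => //.
  by apply: (symbolM (m1 := 0)) => //; exact: symbol_decay_dirn2.
- apply: symbolMl; apply: (@symbol_le _ 4) => //.
  apply: (symbolM (m1 := 0)); last exact: symbol_decay_dirn2.
  by apply: symbolD; [exact: symbolMl|exact: symbol_cst].
Qed.

Lemma asymptotically_deSitter_perturbed :
  asymptotically_deSitter Lam P 1 g K (momentum_density Lam st f).
Proof.
split.
- by split => //; lra.
(* Radius and Hoelder exponent are arbitrary choices: the symbol estimates hold on all of R^3 and
   for every exponent between 0 and 1. *)
- exists 1, 2^-1; split => //; first lra.
    by move=> i j; apply: (@symbol_weighted_holder _ _ _ _ 1); [lra|exact: symbol_rescaled_metric].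
  move=> i j; rewrite -(natrD R 1 1).
  by apply: (@symbol_weighted_holder _ _ _ _ 2); [lra|exact: symbol_rescaled_h].
- apply: symbol_integrable_vol; first exact: symbol_scalar_curv.
  exact: symbol_metric.
- move=> i; apply: symbol_integrable_vol; last exact: symbol_metric.
  rewrite (_ : (fun x => _) = fun=> 0); first exact: symbol0.
  by apply/funext => x; rewrite momentum_density_deSitter// mxE.
Qed.

Lemma trace_rank_one (a b c' d : R) (v : 'I_3 -> R) :
  \sum_i \sum_j (a * (i == j)%:R + b * (v i * v j)) * (c' * (j == i)%:R + d * (v j * v i)) =
  3 * a * c' + (a * d + b * c') * (\sum_i v i ^+ 2) + b * d * (\sum_i v i ^+ 2) ^+ 2.
Proof.
rewrite !big_ord_recl !big_ord0 /= ?(mulr1n, mulr0n).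
move: (v _) (v _) (v _) => v0 v1 v2; ring.
Qed.

Lemma mtraceE (b d : 'M[R]_3) : mtrace b d = \sum_i \sum_j invmx b i j * d j i.
Proof. by apply: eq_bigr => i _; rewrite mxE. Qed.

(** The first summand is the expansion rate 3 / lam corrected by the tilt. In the second, the
    Hessian 3 p p - delta has Euclidean trace 3 q - 3 = - 3 s^2, and what else is left carries the
    factor y of order 4, so all of it is O(s^5). *)
Lemma trace_second_ff x (V := tilt lam f x) (y := slope lam f x)
    (ai := P ^- 2 * expdecay (- c) x) (q := 1 - s x ^+ 2) :
  mtrace (g x) (K x) = V ^+ 3 * (3 - 4 * y) / lam +
    V * eps * s x ^+ 3 * ai * (- 3 * s x ^+ 2 + V ^+ 2 * y * (3 * q - 1)).
Proof.
rewrite mtraceE.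
have aE : P ^+ 2 * expdecay c x = ai^-1 by rewrite /ai -expdecayN invfM !invrK.
have ai0 : ai != 0.
  by rewrite mulf_neq0 ?invr_eq0 ?expf_neq0// lt0r_neq0// expdecay_gt0.
have yE : y = eps ^+ 2 * s x ^+ 4 * q * ai by rewrite /y slope_perturbed_time// /ai /q; ring.
have VE : V ^+ 2 * (1 - y) = 1 by exact: tilt_sqr.
transitivity (\sum_i \sum_j (ai * (i == j)%:R + V ^+ 2 * ai ^+ 2 * eps ^+ 2 * s x ^+ 4 * (p i x * p j x)) *
   (V * (- (eps * s x ^+ 3) + ai^-1 / lam) * (j == i)%:R +
    V * (3 * eps * s x ^+ 3 - 2 / lam * eps ^+ 2 * s x ^+ 4) * (p j x * p i x))).
  apply: eq_bigr => i _; apply: eq_bigr => j _.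
  rewrite invmx_induced_metric_perturbed// second_ff_perturbed// aE -/ai -/V.
  congr (_ * _); ring.
rewrite (trace_rank_one _ _ _ _ (fun i => p i x)) dirn_sqr_sum -/q.
have sE : s x ^+ 2 = 1 - q by rewrite /q; ring.
(* A multiple of the relation V^2 (1 - y) = 1, chosen so that adding it turns the claim into an
   identity of rational functions. *)
have Z : V / lam * (3 - 2 * y) * (1 - V ^+ 2 * (1 - y)) = 0 by rewrite VE subrr mulr0.
rewrite -[RHS]addr0 -Z.
rewrite /q in yE *; clear Z VE sE q aE; clearbody V y ai; move: (s x) yE ai0 => d -> ai0.
by field; rewrite lam0 ai0.
Qed.

(* V >= 1 + y/2 turns the leading part of the trace into 3 + y/2 - O(y^2). *)
Let tilt_lower (V y : R) : 0 < V -> V ^+ 2 * (1 - y) = 1 -> 0 <= y <= 100^-1 ->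
  3 + y / 4 <= V ^+ 3 * (3 - 4 * y) /\ V <= 2.
Proof.
move=> V0 VE /andP[y0 y1].
have V2 : 1 + y <= V ^+ 2.
  rewrite -(@ler_pM2r _ (1 - y)); last lra.
  by rewrite VE; nra.
have V1 : 1 + y / 2 <= V.
  rewrite -(@ler_pXn2r _ 2)// ?nnegrE; [|lra|exact: ltW].
  rewrite -(@ler_pM2r _ (1 - y)); last lra.
  by rewrite VE; nra.
have V3 : (1 + y / 2) * (1 + y) <= V ^+ 3 by rewrite exprS ler_pM//; lra.
split; last by nra.
apply: (@le_trans _ _ ((1 + y / 2) * (1 + y) * (3 - 4 * y))).
  by nra.
by rewrite ler_wpM2r//; lra.
Qed.

(** Here l = lam, d = s, d^4 h = y, e = eps and [a] is the factor [ai]. The tilt gains d^4 h / (4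
    l), the other terms lose at most d^5 times 2 |e| a (3 + 4 h); the last hypothesis compares the
    two after division by d^4. *)
Let trace_lower_bound (l V h d a e : R) : 0 < l -> 0 < V -> 0 < d <= 1 -> 0 < a -> 0 <= h ->
  V ^+ 2 * (1 - d ^+ 4 * h) = 1 -> d ^+ 4 * h <= 100^-1 ->
  0 < h / (4 * l) - d * (2 * `|e| * a * (3 + 4 * h)) ->
  3 / l < V ^+ 3 * (3 - 4 * (d ^+ 4 * h)) / l +
    V * e * d ^+ 3 * a * (- 3 * d ^+ 2 + V ^+ 2 * (d ^+ 4 * h) * (3 * (1 - d ^+ 2) - 1)).
Proof.
move=> l0 V0 /andP[d0 d1] a0 h0 VE y1 Rp.
have d2 : 0 <= d ^+ 2 <= 1 by rewrite sqr_ge0 expr_le1// ltW.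
have d4h : 0 <= d ^+ 4 * h by rewrite mulr_ge0// exprn_ge0// ltW.
have y01 : 0 <= d ^+ 4 * h <= 100^-1 by rewrite d4h.
have [V3 V2] := tilt_lower V0 VE y01.
have lead : 3 / l + d ^+ 4 * h / (4 * l) <= V ^+ 3 * (3 - 4 * (d ^+ 4 * h)) / l.
  have -> : 3 / l + d ^+ 4 * h / (4 * l) = (3 + d ^+ 4 * h / 4) / l.
    by field; exact: lt0r_neq0.
  by rewrite ler_pM2r ?invr_gt0.
have Rp4 : 0 < d ^+ 4 * (h / (4 * l) - d * (2 * `|e| * a * (3 + 4 * h))).
  by rewrite mulr_gt0// exprn_gt0.
have B : `|- 3 * d ^+ 2 + V ^+ 2 * (d ^+ 4 * h) * (3 * (1 - d ^+ 2) - 1)| <=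
    d ^+ 2 * (3 + 4 * h).
  have -> : d ^+ 4 = d ^+ 2 * d ^+ 2 by ring.
  have W2 : V ^+ 2 <= 2.
    have : V ^+ 2 * (1 - d ^+ 4 * h) <= 1 by rewrite VE.
    have := sqr_ge0 V; move: (V ^+ 2) (d ^+ 4 * h) y1 => W y y1 W0; nra.
  have W0 := sqr_ge0 V; move: W2 W0 d2; move: (V ^+ 2) (d ^+ 2) => W D W2 W0 /andP[D0 D1].
  have WDh : 0 <= W * (D * D * h) <= 2 * (D * h).
    have DDh : D * D * h <= D * h by rewrite ler_wpM2r// ler_piMr.
    have DDh0 : 0 <= D * D * h by rewrite !mulr_ge0.
    by rewrite mulr_ge0//= ler_pM.
  move: WDh; move: (W * (D * D * h)) => Z /andP[Z0 Z1].
  have Dh : 0 <= D * h by rewrite mulr_ge0.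
  rewrite ler_norml; apply/andP; split; nra.
have rem : `|V * e * d ^+ 3 * a * (- 3 * d ^+ 2 + V ^+ 2 * (d ^+ 4 * h) * (3 * (1 - d ^+ 2) - 1))|
    <= d ^+ 4 * (d * (2 * `|e| * a * (3 + 4 * h))).
  rewrite [leLHS]normrM.
  have -> : d ^+ 4 * (d * (2 * `|e| * a * (3 + 4 * h))) =
     (2 * `|e| * d ^+ 3 * a) * (d ^+ 2 * (3 + 4 * h)) by ring.
  apply: ler_pM => //.
  rewrite (normrM _ a) (normrM _ (d ^+ 3)) (normrM V e).
  rewrite (ger0_norm (ltW V0)) (ger0_norm (ltW a0)) (ger0_norm (exprn_ge0 3 (ltW d0))).
  apply: ler_wpM2r; first exact: ltW.
  apply: ler_wpM2r; first by rewrite exprn_ge0// ltW.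
  by apply: ler_wpM2r.
move: rem; rewrite ler_norml => /andP[rem _].
have E : d ^+ 4 * (h / (4 * l) - d * (2 * `|e| * a * (3 + 4 * h))) =
  d ^+ 4 * h / (4 * l) - d ^+ 4 * (d * (2 * `|e| * a * (3 + 4 * h))).
  by rewrite mulrBr; congr (_ - _); exact: mulrA.
rewrite E in Rp4.
move: lead rem Rp4; move: (V * _) (d ^+ 4 * h / _) (d ^+ 4 * (d * _)) (V ^+ 3 * _ / l) (3 / l).
by move=> A B' C D E' *; lra.
Qed.

Lemma trace_second_ff_gt : eps != 0 ->
  exists2 r0 : R, 0 <= r0 & forall x, r0 < enorm x -> 3 / lam < mtrace (g x) (K x).
Proof.
move=> eps0.
(* [yh] is slope / s^4 and [Rm] is gain minus loss over s^4, both as functions of t = s. Infinity is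
   t = 0, where [Rm] equals P^-2 eps^2 / (4 lam), positive as eps is nonzero; continuity at 0 does
   the rest. *)
pose yh (t : R) : R := P ^- 2 * eps ^+ 2 * (expR (- c * t) * (1 - t ^+ 2)).
pose Rm (t : R) : R := yh t / (4 * lam) - t * (2 * `|eps| * (P ^- 2 * expR (- c * t)) * (3 + 4 * yh t)).
have cexp : {for (0 : R), continuous (fun t : R => expR (- c * t))}.
  apply: (@continuous_comp _ _ _ (fun t : R => - c * t) expR).
    by apply: cvgM; [exact: cvg_cst|exact: cvg_id].
  exact: continuous_expR.
have cX n : {for (0 : R), continuous (fun t : R => t ^+ n)} by exact: exprn_continuous.
have cyh : {for (0 : R), continuous yh}.
  apply: cvgM; first exact: cvg_cst.
  apply: cvgM; first exact: cexp.
  by apply: cvgB; [exact: cvg_cst|exact: cX].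
have cR : {for (0 : R), continuous Rm}.
  apply: cvgB; first by apply: cvgM => //; exact: cvg_cst.
  apply: cvgM; first exact: cvg_id.
  apply: cvgM.
    apply: cvgM; first exact: cvg_cst.
    by apply: cvgM; [exact: cvg_cst|exact: cexp].
  by apply: cvgD; [exact: cvg_cst|apply: cvgM; [exact: cvg_cst|exact: cyh]].
have cT : {for (0 : R), continuous (fun t : R => t ^+ 4 * yh t)} by apply: cvgM => //; exact: cX.
have R0 : 0 < Rm 0.
  have y0 : yh 0 = P ^- 2 * eps ^+ 2 by rewrite /yh mulr0 expR0; ring.
  rewrite /Rm mul0r subr0 y0.
  have e2 : 0 < eps ^+ 2 by rewrite exprn_even_gt0.
  have P2 : 0 < P ^- 2 by rewrite invr_gt0 exprn_gt0.
  by apply: divr_gt0; apply: mulr_gt0.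
have T0 : (0 : R) ^+ 4 * yh 0 < 100^-1 by rewrite expr0n mul0r invr_gt0.
have : \forall t \near (0 : R), 0 < Rm t /\ t ^+ 4 * yh t < 100^-1.
  by near=> t; split; near: t; [exact: (cvgr_gt _ cR)|exact: (cvgr_lt _ cT)].
(* The weight is at least |x|, so |x| > 1 / d forces s < d. *)
move=> [d /= d0 Hd]; exists d^-1; first by rewrite invr_ge0 ltW.
move=> x xd.
have s0 := decay_gt0 x; have s1 := decay_le1 x.
have sd : s x < d.
  rewrite /decay -[d]invrK ltf_pV2 ?posrE ?weight_gt0 ?invr_gt0//.
  apply: (lt_le_trans xd).
  by rewrite -[leLHS]ger0_norm ?sqrtr_ge0// -sqrtr_sqr ler_wsqrtr// lerDr.
have [Rp Tp] : 0 < Rm (s x) /\ s x ^+ 4 * yh (s x) < 100^-1.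
  by apply: Hd; rewrite /= sub0r normrN ger0_norm// ltW.
rewrite trace_second_ff.
have yE : slope lam f x = s x ^+ 4 * yh (s x).
  by rewrite slope_perturbed_time// /yh /expdecay; ring.
have VE := tilt_sqr slope_le x; rewrite yE in VE.
rewrite yE; apply: trace_lower_bound => //.
- exact: tilt_gt0.
- by rewrite s0.
- by rewrite mulr_gt0 ?expdecay_gt0// invr_gt0 exprn_gt0.
- have := slope_ge0 lam t0 eps x; rewrite yE pmulr_rge0//; exact: exprn_gt0.
- exact: ltW.
Unshelve. all: by end_near.
Qed.



Let rescaled_metricE i j : (fun y => rescaled_metric P g y i j) =
  fun y => expdecay c y * (i == j)%:R + - (P ^- 2 * eps ^+ 2) * (s y ^+ 4 * p i y * p j y).
Proof. by apply/funext => y; rewrite rescaled_metric_perturbed mulNr. Qed.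

Let partial_pp k i j x : partial k (fun y => s y ^+ 4 * p i y * p j y) x =
  s x ^+ 5 * ((k == i)%:R * p j x + (k == j)%:R * p i x - 6 * p k x * p i x * p j x).
Proof.
have ds := @differentiable_decay R x.
have di := @differentiable_dirn R i x; have dj := @differentiable_dirn R j x.
have d2 : differentiable (fun y => s y * s y) x by exact: (differentiableM ds ds).
have d4 : differentiable (fun y => s y * s y * (s y * s y)) x by exact: (differentiableM d2 d2).
have d5 : differentiable (fun y => s y * s y * (s y * s y) * p i y) x by exact: (differentiableM d4 di).
rewrite (_ : (fun y => _) = fun y => s y * s y * (s y * s y) * p i y * p j y); last first.
  by apply/funext => y; ring.
rewrite (partialM k d5 dj) (partialM k d4 di) (partialM k d2 d2) (partialM k ds ds).
rewrite partial_decay !partial_dirn.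
by move: (s x) (p i x) (p j x) (p k x) => *; ring.
Qed.

Let partial_rescaled_metric k i j x : partial k (fun y => rescaled_metric P g y i j) x =
  - (i == j)%:R * (c * expdecay c x * s x ^+ 2 * p k x) - P ^- 2 * eps ^+ 2 * (s x ^+ 5 *
    ((k == i)%:R * p j x + (k == j)%:R * p i x - 6 * p k x * p i x * p j x)).
Proof.
rewrite rescaled_metricE.
have de := differentiable_expdecay c x.
have dc (b : R) : differentiable (fun _ : 'rV[R]_3 => b) x by exact: differentiable_cst.
have d1 : differentiable (fun y => expdecay c y * (i == j)%:R) x by exact: differentiableM.
have dpp : differentiable (fun y => s y ^+ 4 * p i y * p j y) x.
  exact: symbol_differentiable (symbol_decay_dirn2 4 i j).
have d2 : differentiable (fun y => - (P ^- 2 * eps ^+ 2) * (s y ^+ 4 * p i y * p j y)) x.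
  exact: differentiableM.
rewrite (partialD k d1 d2) (partialM k de (dc _)) partial_cst partial_expdecay.
by rewrite (partialMl k _ dpp) partial_pp; ring.
Qed.

(** Puts a free index into the [lift] form produced by [big_ord_recl], so that the Kronecker deltas
    compute and equal coordinates become syntactically equal. *)
Let ord3_case (Q : 'I_3 -> Prop) : Q ord0 -> Q (lift ord0 ord0) ->
  Q (lift ord0 (lift ord0 ord0)) -> forall i, Q i.
Proof.
move=> Q0 Q1 Q2 [[|[|[|//]]] lti].
- by rewrite (_ : Ordinal lti = ord0)//; exact: val_inj.
- by rewrite (_ : Ordinal lti = lift ord0 ord0)//; exact: val_inj.
- by rewrite (_ : Ordinal lti = lift ord0 (lift ord0 ord0))//; exact: val_inj.
Qed.

(** The factor 2 c is 3 c from the trace minus c from the divergence of the conformal part. The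
    rank-one part df df enters only with s^5, too small to reach the limit. *)
Lemma energy_density x i :
  \sum_j (partial j (fun y => rescaled_metric P g y i j) x
          - partial i (fun y => rescaled_metric P g y j j) x) =
  (2 * c * expdecay c x * s x ^+ 2 - 2 * (P ^- 2 * eps ^+ 2) * s x ^+ 5) * p i x.
Proof.
under eq_bigr do rewrite !partial_rescaled_metric.
rewrite !big_ord_recl big_ord0.
move: i; apply: ord3_case; rewrite /= ?(mulr1n, mulr0n);
  move: (P ^- 2) (expdecay c x) (s x) (p _ x) (p _ x) (p _ x) => ? ? ? ? ? ?; ring.
Qed.

Let dist (r : R) : R := (Num.sqrt (1 + r ^+ 2))^-1.

Let decay_sphere r x : \sum_i x 0 i ^+ 2 = r ^+ 2 -> s x = dist r.
Proof. by move=> xr; rewrite decayE xr. Qed.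

Let dirn_coord_sum r x : \sum_i x 0 i ^+ 2 = r ^+ 2 ->
  \sum_i p i x * x 0 i = s x * r ^+ 2.
Proof. by move=> <-; rewrite mulr_sumr; apply: eq_bigr => i _; rewrite /dirn; ring. Qed.

Lemma energy_atE (r : R) : 0 < r -> energy_at P g r =
  P / 2 * (dist r * r) ^+ 3 * (c * expR (c * dist r) - P ^- 2 * eps ^+ 2 * dist r ^+ 3).
Proof.
move=> r0; have r0' := lt0r_neq0 r0.
rewrite /energy_at /flux (@sphere_integral_cst _ _
  ((2 * c * expR (c * dist r) * dist r ^+ 2 - 2 * (P ^- 2 * eps ^+ 2) * dist r ^+ 5)
   * (dist r * r))).
  move: (pi_gt0 R); move: pi => z /lt0r_neq0 z0.
  by field; rewrite P0 lam0.
move=> x xr.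
under eq_bigr do rewrite mxE energy_density -mulrA (mulrA (p _ x)).
rewrite -mulr_sumr -mulr_suml (dirn_coord_sum xr) /expdecay (decay_sphere xr).
by congr (_ * _); field.
Qed.

Let dist_cvg0 : dist r @[r --> +oo] --> (0 : R).
Proof.
apply/cvgr0Pnorm_le => e e0; near=> r.
have r0 : 0 < r by near: r; apply: nbhs_pinfty_gt; exact: num_real.
have re : e^-1 <= r by near: r; apply: nbhs_pinfty_ge; exact: num_real.
rewrite ger0_norm ?invr_ge0 ?sqrtr_ge0// -[e]invrK lef_pV2 ?posrE ?invr_gt0//; last first.
  by rewrite sqrtr_gt0 ltr_pwDl// sqr_ge0.
apply: (le_trans re); rewrite -[leLHS](ger0_norm (ltW r0)) -sqrtr_sqr ler_wsqrtr//.
by rewrite lerDr.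
Unshelve. all: by end_near.
Qed.

(** Makes the energy at radius r a function of [dist r] alone, continuous at 0, so that the limit at
    infinity becomes an evaluation. *)
Let dist_mulr r : 0 < r -> dist r * r = Num.sqrt (1 - dist r ^+ 2).
Proof.
move=> r0; have h : 0 < 1 + r ^+ 2 by rewrite ltr_pwDl// sqr_ge0.
have -> : 1 - dist r ^+ 2 = (dist r * r) ^+ 2.
  rewrite exprMn {1 2}/dist exprVn sqr_sqrtr ?ltW//; field; exact: lt0r_neq0.
by rewrite sqrtr_sqr ger0_norm// mulr_ge0 ?invr_ge0 ?sqrtr_ge0//; exact: ltW.
Qed.

Lemma energy_at_cvg : energy_at P g r @[r --> +oo] --> eps / lam * P.
Proof.
pose G (t : R) : R := P / 2 * Num.sqrt (1 - t ^+ 2) ^+ 3 *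
  (c * expR (c * t) - P ^- 2 * eps ^+ 2 * t ^+ 3).
have cX n : {for (0 : R), continuous (fun t : R => t ^+ n)} by exact: exprn_continuous.
have cG : {for (0 : R), continuous G}.
  apply: cvgM.
    apply: cvgM; first exact: cvg_cst.
    apply: (@continuous_comp _ _ _ (fun t : R => Num.sqrt (1 - t ^+ 2)) (fun z => z ^+ 3)).
      apply: (@continuous_comp _ _ _ (fun t : R => 1 - t ^+ 2) Num.sqrt).
        by apply: cvgB; [exact: cvg_cst|exact: cX].
      exact: sqrt_continuous.
    exact: exprn_continuous.
  apply: cvgB; last by apply: cvgM; [exact: cvg_cst|exact: cX].
  apply: cvgM; first exact: cvg_cst.
  apply: (@continuous_comp _ _ _ (fun t : R => c * t) expR).
    by apply: cvgM; [exact: cvg_cst|exact: cvg_id].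
  exact: continuous_expR.
have G0 : G 0 = eps / lam * P.
  have -> : G 0 = P / 2 * Num.sqrt 1 ^+ 3 * (c * expR 0).
    by rewrite /G mulr0 expr0n subr0 expr0n mulr0 subr0.
  by rewrite sqrtr1 expR0; field.
rewrite -G0; have cGd : G (dist r) @[r --> +oo] --> G 0.
  exact: (cvg_comp _ _ dist_cvg0 cG).
apply: cvg_trans cGd; apply: near_eq_cvg; near=> r.
have r0 : 0 < r by near: r; apply: nbhs_pinfty_gt; exact: num_real.
by rewrite /G energy_atE// dist_mulr.
Unshelve. all: by end_near.
Qed.

Lemma pos_def_unitmx (n : nat) (b : 'M[R]_n) : pos_def b -> b \in unitmx.
Proof.
move=> [_ bpos]; rewrite -row_free_unit -kermx_eq0.
apply/rowV0P => v /sub_kermxP vb; apply/eqP; apply: contraT => /bpos.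
by rewrite vb mul0mx mxE ltxx.
Qed.

(** The precise value is immaterial: the formula serves to show that the trace depends on x through
    s alone. *)
Let trace_h_radial x : mtrace (rescaled_metric P g x) (rescaled_h Lam P g K x) =
  3 * expdecay (- c) x * hdiag x + (expdecay (- c) x * hrank1 x
   + P ^+ 2 * (tilt lam f x ^+ 2 * (P ^- 2 * expdecay (- c) x) ^+ 2 * (eps ^+ 2 * s x ^+ 4))
     * hdiag x) * (1 - s x ^+ 2)
  + P ^+ 2 * (tilt lam f x ^+ 2 * (P ^- 2 * expdecay (- c) x) ^+ 2 * (eps ^+ 2 * s x ^+ 4))
     * hrank1 x * (1 - s x ^+ 2) ^+ 2.
Proof.
have gu : g x \in unitmx by apply: pos_def_unitmx; exact: spacelike_perturbed.
have ru : rescaled_metric P g x \in unitmx.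
  by rewrite unitmxZ// unitfE invr_eq0 expf_neq0.
rewrite mtraceE -dirn_sqr_sum -(trace_rank_one _ _ _ _ (fun i => p i x)).
apply: eq_bigr => i _; apply: eq_bigr => j _.
rewrite rescaled_h_perturbed /rescaled_metric invmxZ// mxE invrK.
rewrite invmx_induced_metric_perturbed//; congr (_ * _).
by field.
Qed.

Let radial x y : s x = s y -> [/\ expdecay c x = expdecay c y,
  hdiag x = hdiag y, hrank1 x = hrank1 y &
  mtrace (rescaled_metric P g x) (rescaled_h Lam P g K x) =
  mtrace (rescaled_metric P g y) (rescaled_h Lam P g K y)].
Proof.
move=> xy; have E d : expdecay d x = expdecay d y by rewrite /expdecay xy.
have T : tilt lam f x = tilt lam f y by rewrite /tilt !slope_perturbed_time// xy E.
have hd : hdiag x = hdiag y by rewrite /hdiag T xy E.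
have hr : hrank1 x = hrank1 y by rewrite /hrank1 T xy.
split; [exact: E|exact: hd|exact: hr|].
by rewrite (trace_h_radial x) (trace_h_radial y) hd hr xy E T.
Qed.

(* The momentum flux density is a radial multiple of x_k, hence odd. *)
Lemma momentum_at0 k (r : R) : 0 < r -> momentum_at Lam P g K k r = 0.
Proof.
move=> r0; have r0' := lt0r_neq0 r0.
(* A reference point of the sphere, at which all radial coefficients are evaluated so that they
   become constants. *)
pose x0 : 'rV[R]_3 := vec3 0 0 r.
have x0r : \sum_i x0 0 i ^+ 2 = r ^+ 2.
  by rewrite !big_ord_recl big_ord0 !mxE /=; ring.
set tr := mtrace (rescaled_metric P g x0) (rescaled_h Lam P g K x0).
rewrite /momentum_at /flux (@sphere_integral_coord _ _
  ((hdiag x0 + hrank1 x0 * s x0 ^+ 2 * r ^+ 2 - (expdecay c x0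
    - P ^- 2 * eps ^+ 2 * s x0 ^+ 6 * r ^+ 2) * tr) / r) k) ?mulr0//.
move=> x xr.
have sx : s x = s x0 by rewrite (decay_sphere xr) (decay_sphere x0r).
have [Ex hd hr trx] := radial sx.
under eq_bigr do rewrite mxE trx rescaled_h_perturbed rescaled_metric_perturbed -/tr Ex hd hr.
transitivity (\sum_i ((k == i)%:R * ((hdiag x0 - expdecay c x0 * tr) / r * x 0 i)
  + (hrank1 x0 + P ^- 2 * eps ^+ 2 * s x ^+ 4 * tr) * p k x / r * (p i x * x 0 i))).
  by apply: eq_bigr => i _; ring.
rewrite big_split/= sum_delta -mulr_sumr (dirn_coord_sum xr).
rewrite /dirn sx; move: (hdiag x0) (hrank1 x0) (expdecay c x0) tr (s x0) (x 0 k).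
by move=> A B e t d xk; ring.
Qed.

End PerturbedSliceCharges.

(** The bound 1 gives |c| <= 2 / lam, so that the exponential in the slope is at most e^(2 / lam).
    The other bound makes P^-2 eps^2 at most e^(-2 / lam) / 4, and since s^4 (1 - s^2) <= 1 the
    slope is at most 1/4. *)
Lemma slope_small (R : realType) (lam t0 eps : R) : 0 < lam ->
  `|eps| < Num.min 1 (expR (t0 / lam) * expR (- lam^-1) / 2) ->
  forall x, slope lam (perturbed_time t0 eps) x <= 2^-1.
Proof.
move=> lam_gt0; rewrite lt_min => /andP[e1 e2] x.
rewrite slope_perturbed_time//; set Q := expR (t0 / lam) in e2 *.
have Q0 : 0 < Q by exact: expR_gt0.
have s0 := decay_gt0 x; have s1 := decay_le1 x.
have E1 : expdecay (- (2 * eps / lam)) x <= expR lam^-1 ^+ 2.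
  apply: (le_trans (expdecay_le _ _)); rewrite expr2 -expRD ler_expR normrN normrM normrM.
  rewrite (ger0_norm (ltW _ : 0 <= 2)) ?ltr0n// (@ger0_norm _ lam^-1) ?invr_ge0 ?(ltW lam_gt0)//.
  rewrite (_ : lam^-1 + lam^-1 = 2 * lam^-1); last by ring.
  apply: ler_wpM2r; first by rewrite invr_ge0 ltW.
  by lra.
have e4 : eps ^+ 2 <= Q ^+ 2 * expR (- lam^-1) ^+ 2 / 4.
  have -> : Q ^+ 2 * expR (- lam^-1) ^+ 2 / 4 = (Q * expR (- lam^-1) / 2) ^+ 2 by field.
  rewrite -[eps ^+ 2]real_normK ?num_real// lerXn2r ?nnegrE//; last exact: ltW.
  by rewrite divr_ge0 ?mulr_ge0 ?expR_ge0.
have D : decay x ^+ 4 * (1 - decay x ^+ 2) <= 1.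
  by rewrite mulr_ile1 ?exprn_ge0 ?exprn_ile1 ?subr_ge0 ?exprn_ile1// ?(ltW s0)// lerBlDr lerDl exprn_ge0 ?(ltW s0).
have D0 : 0 <= decay x ^+ 4 * (1 - decay x ^+ 2).
  by rewrite mulr_ge0 ?exprn_ge0 ?subr_ge0 ?exprn_ile1 ?(ltW s0).
have Q2 : 0 < Q ^- 2 by rewrite invr_gt0 exprn_gt0.
apply: (@le_trans _ _ (Q ^- 2 * (Q ^+ 2 * expR (- lam^-1) ^+ 2 / 4) * (expR lam^-1 ^+ 2 * 1))).
  apply: ler_pM.
  - by rewrite mulr_ge0 ?sqr_ge0 ?(ltW Q2).
  - by rewrite mulr_ge0// ltW// expdecay_gt0.
  - by rewrite ler_pM2l.
  - by apply: ler_pM => //; exact: expR_ge0.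
rewrite expRN; set E := expR lam^-1; have E0 : 0 < E by exact: expR_gt0.
rewrite (_ : _ * _ = 4^-1); first lra.
by field; rewrite !lt0r_neq0.
Qed.

Theorem mainTheorem1 (R : realType) (lam Lam t0 : R) (lam_gt0 : 0 < lam)
    (LamE : Lam = 3 / lam ^+ 2) :
  exists2 eps0 : R, 0 < eps0 & forall eps : R, `|eps| < eps0 ->
    let st := deSitter lam in
    let f := perturbed_time t0 eps in
    let P := expR (t0 / lam) in
    let g := induced_metric st f in
    let K := second_ff st f in
    let T0 := momentum_density Lam st f in
    let trK := fun x => mtrace (g x) (K x) in
    [/\ (embedding (graph f) /\ spacelike st f) /\
        (exists tau : R, asymptotically_deSitter Lam P tau g K T0),
        [/\ cvg (energy_at P g r @[r --> +oo]),
            total_energy P g = eps / lam * expR (t0 / lam),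
            forall k : 'I_3, cvg (momentum_at Lam P g K k r @[r --> +oo]) /\
                             total_momentum Lam P g K k = 0 &
            eps < 0 -> total_energy P g < 0] &
        eps != 0 ->
          [/\ exists r0 : R, forall x, r0 < enorm x -> 3 / lam < trK x,
              3 / lam = Num.sqrt (3 * Lam) &
              ~ (forall x, trK x <= Num.sqrt (3 * Lam))]].
Proof.
exists (Num.min 1 (expR (t0 / lam) * expR (- lam^-1) / 2)).
  by rewrite lt_min ltr01/= divr_gt0// mulr_gt0 ?expR_gt0.
move=> eps /(slope_small lam_gt0) slope_le st f P g K T0 trK.
have Ecvg : energy_at P g r @[r --> +oo] --> eps / lam * P by exact: energy_at_cvg.
have Elim : total_energy P g = eps / lam * P by exact: cvg_lim Ecvg.
have Mcvg k : momentum_at Lam P g K k r @[r --> +oo] --> (0 : R).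
  (* The momentum integral vanishes at every positive radius, not only in the limit. *)
  apply: cvg_near_cst.
  have : \forall r \near +oo, 0 < (r : R) by apply: nbhs_pinfty_gt; exact: num_real.
  by apply: filterS => r r0; exact: momentum_at0.
split.
- split; first by split; [exact: embedding_graph|exact: spacelike_perturbed].
  by exists 1; exact: asymptotically_deSitter_perturbed.
- split => //.
  + by apply/cvg_ex; exists (eps / lam * P).
  + by move=> k; split; [apply/cvg_ex; exists 0|exact: cvg_lim (Mcvg k)].
  + by move=> e0; rewrite Elim pmulr_llt0 ?expR_gt0// pmulr_llt0 ?invr_gt0.
- move=> eps0.
  have [r0 r00 Hr] := trace_second_ff_gt lam_gt0 slope_le eps0.
  have SL : 3 / lam = Num.sqrt (3 * Lam).
    rewrite (_ : 3 * Lam = (3 / lam) ^+ 2).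
      by rewrite sqrtr_sqr ger0_norm// divr_ge0// ltW.
    by rewrite LamE; field; exact: lt0r_neq0.
  split => //; first by exists r0.
  (* A point on the third axis beyond the radius [r0] contradicts the bound. *)
  move=> H; have := H (vec3 0 0 (r0 + 1)); rewrite -SL leNgt Hr//.
  rewrite /enorm !big_ord_recl big_ord0 !mxE /= expr0n !add0r addr0 sqrtr_sqr.
  by rewrite ger0_norm ?ltrDl// addr_ge0.
Qed.
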